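(* There exist universal constants $D_5,D_6>0$ such that the following holds. Let $(Z_k)_{k\in\mathbb N}$ be a Markov chain with kernel $\mathrm Q$ and unique stationary distribution $\mu$ such that $\sup_{z}\|\mathrm Q^k(z,\cdot)-\mu\|_{\mathrm{TV}}\le 2(1/4)^{\lfloor k/t_{\mathrm{mix}}\rfloor}$ for all $k\in\mathbb N$. Let $F\colon\mathcal Z\to\mathbb H^d$ be measurable with $\mu(F)=0$ and $\|\|F\|\|_\infty<\infty$, and let $S_k=\sum_{j=0}^{k-1}F(Z_j)$. Then for any $\delta\in(0,1)$, $n\ge1$ and any probability distribution $\xi$ on $(\mathcal Z,\mathscr Z)$, with $\mathbb P_\xi$-probability at least $1-\delta$, $$\frac1n\sup_{k\le n}\|S_k\|\le D_5\sqrt{\frac{\log(ed/\delta)\,t_{\mathrm{mix}}\,\|\|F\|\|_\infty^2}{n}}+D_6\frac{\log(ed/\delta)\,t_{\mathrm{mix}}\,\|\|F\|\|_\infty}{n}.$$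
   Context: $\mathrm Q$ is a Markov kernel on a measurable space $(\mathcal Z,\mathscr Z)$ with a unique stationary distribution $\mu$; $t_{\mathrm{mix}}$ is a positive integer; $\mathbb N=\{0,1,2,\dots\}$. $\mathbb P_\xi$ is the law of the chain $(Z_k)_{k\in\mathbb N}$ started from $Z_0\sim\xi$. $\|\xi\|_{\mathrm{TV}}=|\xi|(\mathcal Z)$ is the total mass of the total variation measure of a signed measure. $\mathbb H^d$ is the set of $d\times d$ self-adjoint complex matrices, $\|\cdot\|$ the spectral norm, $\|\|F\|\|_\infty=\sup_{z\in\mathcal Z}\|F(z)\|$, $\mu(F)=\int F\,d\mu$. A universal constant is an absolute number not depending on any of the data. *)

(* Defs.v *)
From HB Require Import structures.
From mathcomp Require Import all_boot all_order all_algebra.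
From mathcomp Require Import all_classical all_reals all_analysis.
From mathcomp Require Import complex.

Set Implicit Arguments.
Unset Strict Implicit.
Unset Printing Implicit Defensive.

Import Order.TTheory GRing.Theory Num.Theory.
Import numFieldNormedType.Exports.

Local Open Scope classical_set_scope.
Local Open Scope ring_scope.

Section matrices.
Context (R : realType).

Definition l2norm d (x : 'cV[R[i]]_d) : R :=
  Num.sqrt (\sum_(i < d) Normc.normc (x i 0) ^+ 2).

Definition specnorm d (A : 'M[R[i]]_d) : R :=
  sup [set l2norm (A *m x) | x in [set x | l2norm x <= 1]].

Context dT (T : measurableType dT).

(* 'M[R[i]]_d carries no sigma-algebra in the library; on a finite-dimensional
   space Borel measurability is that of the real coordinates. *)
Definition measurable_mx_fun d (F : T -> 'M[R[i]]_d) : Prop :=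
  forall i j : 'I_d,
    measurable_fun setT (fun z => complex.Re (F z i j)) /\
    measurable_fun setT (fun z => complex.Im (F z i j)).

Definition mxintegral d (mu : {measure set T -> \bar R}) (F : T -> 'M[R[i]]_d)
    : 'M[R[i]]_d :=
  \matrix_(i, j) Complex (\int[mu]_z complex.Re (F z i j))
                         (\int[mu]_z complex.Im (F z i j)).

Definition mxsupnorm d (F : T -> 'M[R[i]]_d) : \bar R :=
  ereal_sup [set (specnorm (F z))%:E | z in setT].

End matrices.

Section total_variation.
Context (R : realType) dT (T : measurableType dT).
Local Open Scope ereal_scope.

(* The value does not depend on the choice of the Hahn decomposition
   (Hahn_decomposition_uniq). *)
Definition tv_norm (nu : {charge set T -> \bar R}) : \bar R :=
  let P_ := cid (Hahn_decomposition nu) in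
  let N_ := cid (projT2 P_) in
  charge_variation (projT2 N_) setT.

Definition prob_diff (p q : probability T R) : {charge set T -> \bar R} :=
  cadd (charge_of_finite_measure p) (copp (charge_of_finite_measure q)).

End total_variation.

Section markov.
Context (R : realType) dT (T : measurableType dT).
Local Open Scope ereal_scope.
Implicit Type Q : R.-pker T ~> T.

Section kernel_comp.
Variables k1 k2 : R.-pker T ~> T.

Let mkcomp_noparam_prob x : mkcomp_noparam k1 k2 x setT = 1.
Proof.
rewrite [LHS](_ : _ = \int[k1 x]_y cst 1 y).
  by rewrite integral_cst// mul1e prob_kernel.
by apply: eq_integral => y _; rewrite prob_kernel.
Qed.

HB.instance Definition _ := Kernel_isProbability.Build _ _ _ _ R
  (mkcomp_noparam k1 k2) mkcomp_noparam_prob.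

Definition pkcomp : R.-pker T ~> T := mkcomp_noparam k1 k2.

End kernel_comp.

Fixpoint kiter Q (n : nat) : R.-pker T ~> T :=
  if n is n'.+1 then pkcomp (kiter Q n') Q else kdirac (@measurable_id _ T setT).

Section kernel_probability.
Variables (k : R.-pker T ~> T) (z : T).

Definition kprob_at : set T -> \bar R := k z.

HB.instance Definition _ := Measure.on kprob_at.

Let kprob_atT : kprob_at setT = 1.
Proof. exact: prob_kernel. Qed.

HB.instance Definition _ := Measure_isProbability.Build _ _ _
  kprob_at kprob_atT.

End kernel_probability.

Definition stationary Q (mu : probability T R) : Prop :=
  forall A, measurable A -> \int[mu]_z Q z A = mu A.

Definition unique_stationary Q (mu : probability T R) : Prop :=
  stationary Q mu /\
  forall nu : probability T R, stationary Q nu ->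
    forall A, measurable A -> nu A = mu A.

Context dO (O : measurableType dO).
Implicit Type Z : nat -> O -> T.

Definition past Z (n : nat) : set (set O) :=
  <<s [set B | exists k, exists2 A, (k <= n)%N /\ measurable A &
                                    B = Z k @^-1` A] >>.

(* The third conjunct is P(Z_{n+1} \in A | Z_0, ..., Z_n) = Q(Z_n, A) a.s.,
   with the conditional probability unfolded. *)
Definition markov_chain Q (xi : probability T R) (P : probability O R) Z
    : Prop :=
  [/\ forall n, measurable_fun setT (Z n),
      forall A, measurable A -> P (Z 0%N @^-1` A) = xi A
    & forall n A B, measurable A -> past Z n B ->
        P (B `&` Z n.+1 @^-1` A) = \int[P]_(w in B) Q (Z n w) A].

End markov.

Definition partial_sum (R : realType) dT (T : measurableType dT)
    dO (O : measurableType dO) d (F : T -> 'M[R[i]]_d) (Z : nat -> O -> T)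
    (k : nat) (w : O) : 'M[R[i]]_d :=
  \sum_(j < k) F (Z j w).

(* Main.v *)
(* Trace moments replace matrix exponentials. For Hermitian A, B and
   D = A - B, expanding A^p twice around B gives
     tr A^p = tr B^p + p tr (B^(p-1) D) + sum of p(p-1)/2 terms tr (B^k D A^l D),
   k + l = p - 2, and in eigenbases of A and B each such term is at most
   |D|^2 (tr A^(p-2) + tr B^(p-2)) for p even. Hence the even trace moments
   T_q(m) = E tr S_m^(2q) of a matrix martingale with differences bounded by s
   satisfy T_(q+1)(m+1) <= T_(q+1)(m) + (q+1)(2q+1) s^2 (T_q(m+1) + T_q(m)), so
   T_q(m) <= d (4 q s^2 (m + q))^q. Applied with q of order log(ed/delta) to the
   martingale stopped when it leaves a ball, Markov's inequality gives the
   maximal deviation bound.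

   For the chain, the martingale is E(S_n | Z_0, ..., Z_j) observed at the
   multiples j of tmix only. It has n / tmix differences of size O(tmix |F|), and
   by mixing it stays within O(tmix |F|) of the partial sums; this blocking is
   what yields a variance of order n tmix rather than n tmix^2. *)

Require Import Defs.
From mathcomp Require Import all_boot all_order all_algebra.
From mathcomp Require Import all_classical all_reals all_analysis.
From mathcomp Require Import complex measurable_realfun.
From mathcomp Require Import ring lra zify.

Set Implicit Arguments.
Unset Strict Implicit.
Unset Printing Implicit Defensive.

Import Order.TTheory GRing.Theory Num.Theory.
Import numFieldNormedType.Exports.
Import Normc.

Local Open Scope classical_set_scope.
Local Open Scope complex_scope.
Local Open Scope ring_scope.
Local Open Scope sesquilinear_scope.

(** * Spectral norm and trace powers *)

Section real_sums.
Context (R : rcfType).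

(** Conditional expectations are never constructed. A martingale difference is a matrix function
    whose entries are orthogonal to every bounded function of the past, and this alone removes the
    first-order trace term. Every integrand is bounded, so the analysis reduces to identities
    between integrals of bounded real functions, checked on indicators and extended by linearity and
    uniform limits.

    The moment bound [d (4 q s^2 (m + q))^q] produces both terms of the deviation. With
    [s = 7 tmix M], [m] about [n / tmix] and [q] of the order of [L = log(ed/delta)], the part in
    [m] gives the square root of [n L tmix M^2] and the part in [q] gives [L tmix M]. As soon as
    [t^2] is at least e times the base of the power, the tail is at most
    [d e^(-q) <= d e^(-L) = delta / e], so the factor [d] of the trace enters only through the
    logarithm. *)

Lemma cauchy_schwarz_sum (I : finType) (a b : I -> R) :
  \sum_i a i * b i <=
  Num.sqrt (\sum_i a i ^+ 2) * Num.sqrt (\sum_i b i ^+ 2).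
Proof.
set A := \sum_i a i ^+ 2; set B := \sum_i b i ^+ 2.
have A0 : 0 <= A by apply: sumr_ge0 => i _; exact: sqr_ge0.
have B0 : 0 <= B by apply: sumr_ge0 => i _; exact: sqr_ge0.
have sum0 (c e : I -> R) : \sum_i c i ^+ 2 = 0 -> \sum_i c i * e i = 0.
  move=> c0; apply: big1 => i _.
  have /eqP := c0; rewrite psumr_eq0; last by move=> j _; exact: sqr_ge0.
  by move=> /allP/(_ i (mem_index_enum _)); rewrite sqrf_eq0 => /eqP ->; rewrite mul0r.
have [A0'|A0'] := eqVneq A 0; first by rewrite (sum0 _ _ A0') A0' sqrtr0 mul0r.
have [B0'|B0'] := eqVneq B 0.
  under eq_bigr do rewrite mulrC.
  by rewrite (sum0 _ _ B0') B0' sqrtr0 mulr0.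
have p0 : 0 < Num.sqrt A by rewrite sqrtr_gt0 lt_def A0' A0.
have q0 : 0 < Num.sqrt B by rewrite sqrtr_gt0 lt_def B0' B0.
set p := Num.sqrt A in p0 *; set q := Num.sqrt B in q0 *.
have pA : p ^+ 2 = A by rewrite sqr_sqrtr.
have qB : q ^+ 2 = B by rewrite sqr_sqrtr.
have : \sum_i (q * a i - p * b i) ^+ 2 >= 0.
  by apply: sumr_ge0 => i _; exact: sqr_ge0.
have e i : (q * a i - p * b i) ^+ 2 = q ^+ 2 * a i ^+ 2 +
  (p ^+ 2 * b i ^+ 2 - (2 * (p * q)) * (a i * b i)) by ring.
under eq_bigr do rewrite e.
rewrite big_split/= sumrB -!mulr_sumr -/A -/B -pA -qB.
rewrite (_ : _ + _ = 2 * (p * q) * (p * q - \sum_i a i * b i)); last by ring.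
by rewrite pmulr_rge0 ?mulr_gt0// subr_ge0.
Qed.

End real_sums.

Section spectral_norm.
Context (R : realType).
Local Notation C := R[i].

Definition sqnorm d (x : 'cV[C]_d) : R := \sum_i normc (x i 0) ^+ 2.

Lemma normc_ge0 (x : C) : 0 <= normc x.
Proof. by case: x => a b; exact: sqrtr_ge0. Qed.

Lemma norm_normc (x : C) : `|x| = (normc x)%:C.
Proof. by case: x. Qed.

Lemma sqr_normcE (x : C) : (normc x ^+ 2)%:C = x * x^*.
Proof. by rewrite rmorphXn/= -norm_normc normCK. Qed.

Lemma Re_le_normc (x : C) : `|complex.Re x| <= normc x.
Proof. by rewrite -lecR -norm_normc; exact: normc_ge_Re. Qed.

Lemma Im_le_normc (x : C) : `|complex.Im x| <= normc x.
Proof.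
case: x => a b /=; rewrite -sqrtr_sqr ler_sqrt ?addr_ge0 ?sqr_ge0//.
by rewrite lerDr sqr_ge0.
Qed.

Lemma normc_conj (x : C) : normc x^* = normc x.
Proof. by apply: complexI; rewrite -!norm_normc norm_conjC. Qed.

Lemma cRe_conj (x : C) : complex.Re x^* = complex.Re x.
Proof. by case: x. Qed.

Lemma cIm_conj (x : C) : complex.Im x^* = - complex.Im x.
Proof. by case: x. Qed.

Lemma cReD (x y : C) : complex.Re (x + y) = complex.Re x + complex.Re y.
Proof. by case: x; case: y. Qed.

Lemma cImD (x y : C) : complex.Im (x + y) = complex.Im x + complex.Im y.
Proof. by case: x; case: y. Qed.

Lemma cReN (x : C) : complex.Re (- x) = - complex.Re x.
Proof. by case: x. Qed.

Lemma cImN (x : C) : complex.Im (- x) = - complex.Im x.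
Proof. by case: x. Qed.

Lemma cReM (x y : C) : complex.Re (x * y) =
  complex.Re x * complex.Re y - complex.Im x * complex.Im y.
Proof. by case: x; case: y. Qed.

Lemma cImM (x y : C) : complex.Im (x * y) =
  complex.Re x * complex.Im y + complex.Im x * complex.Re y.
Proof. by case: x; case: y. Qed.

Lemma cRe_sum I (r : seq I) (Pr : pred I) (f : I -> C) :
  complex.Re (\sum_(i <- r | Pr i) f i) = \sum_(i <- r | Pr i) complex.Re (f i).
Proof. by elim/big_ind2: _ => // a b c e <- <-; rewrite cReD. Qed.

Lemma cIm_sum I (r : seq I) (Pr : pred I) (f : I -> C) :
  complex.Im (\sum_(i <- r | Pr i) f i) = \sum_(i <- r | Pr i) complex.Im (f i).
Proof. by elim/big_ind2: _ => // a b c e <- <-; rewrite cImD. Qed.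

Lemma sqnorm_ge0 d (x : 'cV[C]_d) : 0 <= sqnorm x.
Proof. by apply: sumr_ge0 => i _; exact: sqr_ge0. Qed.

Lemma l2norm_ge0 d (x : 'cV[C]_d) : 0 <= l2norm x.
Proof. exact: sqrtr_ge0. Qed.

Lemma sqr_l2norm d (x : 'cV[C]_d) : l2norm x ^+ 2 = sqnorm x.
Proof. by rewrite /l2norm sqr_sqrtr// sqnorm_ge0. Qed.

Lemma l2norm0_eq0 d (x : 'cV[C]_d) : l2norm x = 0 -> x = 0.
Proof.
move=> x0; have : sqnorm x = 0 by rewrite -sqr_l2norm x0 expr0n.
move=> /eqP; rewrite psumr_eq0; last by move=> j _; exact: sqr_ge0.
move=> /allP h; apply/matrixP => i j; rewrite ord1 mxE.
have := h i (mem_index_enum _); rewrite sqrf_eq0 => /eqP.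
exact: eq0_normc.
Qed.

Lemma l2norm0 d : l2norm (0 : 'cV[C]_d) = 0.
Proof. by rewrite /l2norm big1 ?sqrtr0// => i _; rewrite mxE normc0 expr0n. Qed.

Lemma l2normZ d (a : C) (x : 'cV[C]_d) : l2norm (a *: x) = normc a * l2norm x.
Proof.
rewrite /l2norm; under eq_bigr do rewrite mxE normcM exprMn.
rewrite -mulr_sumr sqrtrM ?sqr_ge0// sqrtr_sqr ger0_norm//.
exact: normc_ge0.
Qed.

Lemma sqnormE d (x : 'cV[C]_d) : (sqnorm x)%:C = (x ^t* *m x) 0 0.
Proof.
rewrite /sqnorm (rmorph_sum (real_complex R))/= mxE; apply: eq_bigr => i _.
by rewrite [LHS]sqr_normcE !mxE mulrC.
Qed.

Lemma Re_dot_le d (x y : 'cV[C]_d) :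
  `|complex.Re ((x ^t* *m y) 0 0)| <= l2norm x * l2norm y.
Proof.
apply: le_trans (cauchy_schwarz_sum (fun i => normc (x i 0)) (fun i => normc (y i 0))).
rewrite mxE cRe_sum (le_trans (ler_norm_sum _ _ _))//; apply: ler_sum => i _.
by rewrite (le_trans (Re_le_normc _))// normcM !mxE normc_conj.
Qed.

Lemma sqnormD d (x y : 'cV[C]_d) :
  sqnorm (x + y) = sqnorm x + sqnorm y + 2 * complex.Re ((x ^t* *m y) 0 0).
Proof.
have h (z : 'cV[C]_d) : sqnorm z = complex.Re ((z ^t* *m z) 0 0).
  by rewrite -sqnormE.
have e : (x + y) ^t* = x ^t* + y ^t*.
  by apply/matrixP => i j; rewrite !mxE rmorphD.
rewrite !h e mulmxDl !mulmxDr !mxE/= !cReD !cRe_sum.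
have -> : \sum_i complex.Re ((y ^t*) 0 i * x i 0) =
    \sum_i complex.Re ((x ^t*) 0 i * y i 0).
  apply: eq_bigr => i _; rewrite !mxE.
  by case: (x i 0) => a b; case: (y i 0) => a' b'; rewrite !cReM !cRe_conj !cIm_conj /=; ring.
by ring.
Qed.

Lemma l2normD d (x y : 'cV[C]_d) : l2norm (x + y) <= l2norm x + l2norm y.
Proof.
rewrite -(@ler_pXn2r _ 2) ?nnegrE ?addr_ge0 ?l2norm_ge0// sqr_l2norm sqnormD sqrrD.
rewrite !sqr_l2norm (addrAC (sqnorm x)) lerD2r lerD2l mulr_natl ler_wMn2r//.
exact: le_trans (ler_norm _) (Re_dot_le _ _).
Qed.
End spectral_norm.

Section spectral_norm2.
Context (R : realType).
Local Notation C := R[i].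

Lemma normc_le_l2norm d (x : 'cV[C]_d) i : normc (x i 0) <= l2norm x.
Proof.
rewrite -[leLHS](ger0_norm (normc_ge0 _)) -sqrtr_sqr ler_sqrt ?sqnorm_ge0//.
by rewrite (bigD1 i)//= lerDl sumr_ge0// => j _; exact: sqr_ge0.
Qed.

Lemma l2norm_le_sum d (x : 'cV[C]_d) : l2norm x <= \sum_i normc (x i 0).
Proof.
have s0 : 0 <= \sum_i normc (x i 0) by apply: sumr_ge0 => i _; exact: normc_ge0.
rewrite -(@ler_pXn2r _ 2) ?nnegrE ?l2norm_ge0// sqr_l2norm expr2 mulr_suml.
apply: ler_sum => i _; rewrite expr2 ler_wpM2l ?normc_ge0//.
by rewrite (bigD1 i)//= lerDl sumr_ge0// => j _; exact: normc_ge0.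
Qed.

(** A crude entrywise constant is enough: it only shows that the set in [specnorm] is bounded, so
    that [sup] is a true supremum and not its default value 0. *)
Lemma l2norm_mul_bounded d (A : 'M[C]_d) :
  exists K, 0 <= K /\ forall x, l2norm (A *m x) <= K * l2norm x.
Proof.
exists (\sum_i \sum_j normc (A i j)); split=> [|x].
  by apply: sumr_ge0 => i _; apply: sumr_ge0 => j _; exact: normc_ge0.
apply: (le_trans (l2norm_le_sum _)); rewrite mulr_suml; apply: ler_sum => i _.
rewrite mxE mulr_suml -lecR -norm_normc.
apply: (le_trans (ler_norm_sum _ _ _)).
rewrite (rmorph_sum (real_complex R)) /=; apply: ler_sum => j _.
by rewrite norm_normc lecR normcM ler_wpM2l ?normc_ge0// normc_le_l2norm.
Qed.

Lemma specnorm_has_sup d (A : 'M[C]_d) :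
  has_sup [set l2norm (A *m x) | x in [set x | l2norm x <= 1]].
Proof.
split.
  by exists (l2norm (A *m 0)), 0 => //=; rewrite l2norm0.
have [K [K0 h]] := l2norm_mul_bounded A.
exists K => _ [x /= x1 <-]; rewrite (le_trans (h x))//.
by rewrite ler_piMr.
Qed.

Lemma specnorm_ge0 d (A : 'M[C]_d) : 0 <= specnorm A.
Proof.
apply: (le_trans (l2norm_ge0 (A *m 0))).
apply: ub_le_sup; first by have [] := specnorm_has_sup A.
by exists 0 => //=; rewrite l2norm0.
Qed.

Lemma l2norm_mul_le d (A : 'M[C]_d) (x : 'cV[C]_d) :
  l2norm (A *m x) <= specnorm A * l2norm x.
Proof.
have [x0|x0] := eqVneq (l2norm x) 0.
  by rewrite x0 mulr0 (l2norm0_eq0 x0) mulmx0 l2norm0.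
have xp : 0 < l2norm x by rewrite lt_def x0 l2norm_ge0.
rewrite -ler_pdivrMr//.
have nc : normc ((l2norm x)^-1)%:C = (l2norm x)^-1.
  apply: complexI; rewrite -norm_normc ger0_norm// ler0c invr_ge0.
  exact: l2norm_ge0.
apply: ub_le_sup; first by have [] := specnorm_has_sup A.
exists (((l2norm x)^-1)%:C *: x).
  by rewrite /= l2normZ nc mulVf.
by rewrite -scalemxAr l2normZ nc mulrC.
Qed.

Lemma specnorm_le d (A : 'M[C]_d) c : 0 <= c ->
  (forall x, l2norm (A *m x) <= c * l2norm x) -> specnorm A <= c.
Proof.
move=> c0 h; apply: ge_sup; first by have [] := specnorm_has_sup A.
by move=> _ [x /= x1 <-]; rewrite (le_trans (h x))// ler_piMr.
Qed.

(** Take [y = A x] and divide by the norm of [A x]. Testing against vectors turns norm bounds on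
    matrix integrals into bounds on real integrals, with no loss in the dimension. *)
Lemma specnorm_le_dot d (A : 'M[C]_d) c : 0 <= c ->
  (forall x y : 'cV[C]_d,
    complex.Re ((y ^t* *m (A *m x)) 0 0) <= c * (l2norm y * l2norm x)) ->
  specnorm A <= c.
Proof.
move=> c0 h; apply: specnorm_le => // x.
have := h x (A *m x); rewrite -sqnormE /= -sqr_l2norm expr2 => h'.
have [->|x0] := eqVneq (l2norm (A *m x)) 0; first by rewrite mulr_ge0 ?l2norm_ge0.
by rewrite -(@ler_pM2l _ (l2norm (A *m x))) ?lt_def ?x0 ?l2norm_ge0// mulrCA.
Qed.

Lemma Re_dot_mul_le d (A : 'M[C]_d) (x y : 'cV[C]_d) :
  `|complex.Re ((y ^t* *m (A *m x)) 0 0)| <= specnorm A * (l2norm y * l2norm x).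
Proof.
rewrite (le_trans (Re_dot_le _ _))// mulrCA ler_wpM2l ?l2norm_ge0//.
exact: l2norm_mul_le.
Qed.

Lemma specnormD d (A B : 'M[C]_d) : specnorm (A + B) <= specnorm A + specnorm B.
Proof.
apply: specnorm_le => [|x]; first by rewrite addr_ge0 ?specnorm_ge0.
by rewrite mulmxDl (le_trans (l2normD _ _))// mulrDl lerD ?l2norm_mul_le.
Qed.

Lemma specnorm0 d : specnorm (0 : 'M[C]_d) = 0.
Proof.
apply/eqP; rewrite eq_le specnorm_ge0 andbT; apply: specnorm_le => // x.
by rewrite mul0mx l2norm0 mul0r.
Qed.

Lemma specnormN d (A : 'M[C]_d) : specnorm (- A) = specnorm A.
Proof.
suff h (B : 'M[C]_d) : specnorm (- B) <= specnorm B.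
  by apply/eqP; rewrite eq_le h -{1}(opprK A) h.
apply: specnorm_le => [|x]; first exact: specnorm_ge0.
by rewrite mulNmx -scaleN1r l2normZ normcN normc1 mul1r l2norm_mul_le.
Qed.

Lemma specnorm_sum d I (r : seq I) (Pr : pred I) (f : I -> 'M[C]_d) :
  specnorm (\sum_(i <- r | Pr i) f i) <= \sum_(i <- r | Pr i) specnorm (f i).
Proof.
elim/big_ind2: _ => //; first by rewrite specnorm0.
by move=> a b A B h1 h2; rewrite (le_trans (specnormD _ _))// lerD.
Qed.

Lemma normc_le_specnorm d (A : 'M[C]_d) i j : normc (A i j) <= specnorm A.
Proof.
have e : l2norm (delta_mx j 0 : 'cV[C]_d) = 1.
  rewrite /l2norm (bigD1 j)//= big1 => [|k kj].
    by rewrite mxE !eqxx normc1 expr1n addr0 sqrtr1.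
  by rewrite mxE (negbTE kj) normc0 expr0n.
rewrite -[leRHS]mulr1 -e (le_trans _ (l2norm_mul_le _ _))//.
rewrite -colE; apply: le_trans (normc_le_l2norm _ i).
by rewrite mxE.
Qed.

Lemma hermsymmxP d (A : 'M[C]_d) : reflect (A ^t* = A) (A \is hermsymmx).
Proof.
apply: (iffP (is_hermitianmxP _ _ _)); rewrite expr0 scale1r.
  by move=> <-.
by move=> ->.
Qed.

Lemma hermsymmxD d (A B : 'M[C]_d) :
  A \is hermsymmx -> B \is hermsymmx -> A + B \is hermsymmx.
Proof.
move=> /hermsymmxP hA /hermsymmxP hB; apply/hermsymmxP.
by rewrite -{2}hA -{2}hB; apply/matrixP => i j; rewrite !mxE rmorphD.
Qed.

Lemma hermsymmxN d (A : 'M[C]_d) : A \is hermsymmx -> - A \is hermsymmx.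
Proof.
move=> /hermsymmxP hA; apply/hermsymmxP.
by rewrite -{2}hA; apply/matrixP => i j; rewrite !mxE rmorphN.
Qed.

Lemma hermsymmx0 d : (0 : 'M[C]_d) \is hermsymmx.
Proof. by apply/hermsymmxP/matrixP => i j; rewrite !mxE conjC0. Qed.

Lemma hermsymmx_sum d I (r : seq I) (Pr : pred I) (f : I -> 'M[C]_d) :
  (forall i, f i \is hermsymmx) -> \sum_(i <- r | Pr i) f i \is hermsymmx.
Proof.
move=> h; elim/big_ind: _ => [| |i _]; [exact: hermsymmx0|exact: hermsymmxD|exact: h].
Qed.

(** A Hermitian matrix is normal, hence unitarily diagonalisable, and its spectrum is real, so the
    eigenvalues are taken in [R]. One [V] serves all powers. *)
Lemma hermsymmx_spectral d (A : 'M[C]_d) : A \is hermsymmx ->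
  exists (V : 'M[C]_d) (a : 'I_d -> R),
    [/\ V *m V ^t* = 1%:M, V ^t* *m V = 1%:M &
        forall k, A ^+ k = V ^t* *m diag_mx (\row_i (a i ^+ k)%:C) *m V].
Proof.
move=> hA; have real := hermitian_spectral_diag_real hA.
have /hermitian_normalmx/orthomx_spectralP := hA.
set V := spectralmx A => eA.
have Vu : V \is unitarymx := spectral_unitarymx A.
have V1 : V *m V ^t* = 1%:M by apply/unitarymxP.
have V2 : V ^t* *m V = 1%:M by rewrite -invmx_unitary// mulVmx// unitarymx_unit.
exists V, (fun i => complex.Re (spectral_diag A 0 i)); split=> // k.
have e i : (complex.Re (spectral_diag A 0 i))%:C = spectral_diag A 0 i.
  by apply: RRe_real; have /mxOverP := real; apply.
elim: k => [|k IH].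
  rewrite expr0 (_ : diag_mx _ = 1%:M) ?mulmx1 ?V2//.
  by apply/matrixP => i j; rewrite !mxE expr0.
rewrite exprSr IH -mulmxE {2}eA invmx_unitary//.
rewrite !mulmxA -(mulmxA _ V) V1 mulmx1 -(mulmxA (V ^t*)) mulmx_diag.
congr (_ *m diag_mx _ *m _); apply/rowP => i; rewrite !mxE.
by rewrite exprSr rmorphM/= e.
Qed.

Lemma l2norm_unitary d (V : 'M[C]_d) (x : 'cV[C]_d) :
  V ^t* *m V = 1%:M -> l2norm (V *m x) = l2norm x.
Proof.
move=> V1; congr Num.sqrt; apply: complexI; rewrite !sqnormE.
by rewrite trmx_mul map_mxM -mulmxA (mulmxA _ V) V1 mul1mx.
Qed.

End spectral_norm2.

Section trace_powers.
Context (R : realType).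
Local Notation C := R[i].

Definition retr d (A : 'M[C]_d) : R := complex.Re (\tr A).

(** The last two clauses identify [specnorm A] with the largest [|a i|], in a form that also covers
    [d = 0]. The lower bound comes from the unit eigenvectors, the upper one from unitary invariance
    of the norm. *)
Lemma hermsymmx_eigenvalues d (A : 'M[C]_d) : A \is hermsymmx ->
  exists a : 'I_d -> R,
    [/\ forall k, retr (A ^+ k) = \sum_i a i ^+ k,
        forall i, `|a i| <= specnorm A &
        forall t, 0 <= t -> (forall i, `|a i| <= t) -> specnorm A <= t].
Proof.
move=> /hermsymmx_spectral[V [a [V1 V2 hA]]]; exists a; split.
- move=> k; rewrite /retr hA mxtrace_mulC mulmxA V1 mul1mx mxtrace_diag cRe_sum.
  by apply: eq_bigr => i _; rewrite mxE.
- move=> i; pose x : 'cV[C]_d := V ^t* *m delta_mx i 0.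
  have x1 : l2norm x = 1.
    rewrite l2norm_unitary; last by rewrite trmxCK.
    rewrite /l2norm (bigD1 i)//= big1 => [|k ki].
      by rewrite mxE !eqxx normc1 expr1n addr0 sqrtr1.
    by rewrite mxE (negbTE ki) normc0 expr0n.
  have <- : l2norm (A *m x) = `|a i|.
    rewrite -[A]expr1 hA /x mulmxA -(mulmxA _ V) V1 mulmx1 -mulmxA mul_diag_mx.
    rewrite (_ : \matrix_(_, _) _ = (a i)%:C *: (delta_mx i 0 : 'cV[C]_d)).
      rewrite -scalemxAr l2normZ -/x x1 mulr1.
      by rewrite /normc/= expr0n/= addr0 sqrtr_sqr.
    apply/matrixP => k l; rewrite !mxE expr1.
    by have [->//|] := eqVneq k i; rewrite !mulr0.
  by rewrite -[leRHS]mulr1 -x1 l2norm_mul_le.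
- move=> t t0 ht; apply: specnorm_le => // x.
  rewrite -[A]expr1 hA -!mulmxA l2norm_unitary; last by rewrite trmxCK.
  rewrite -(l2norm_unitary x V2); set y := V *m x.
  rewrite -(@ler_pXn2r _ 2) ?nnegrE ?mulr_ge0 ?l2norm_ge0// exprMn !sqr_l2norm.
  rewrite mulr_sumr; apply: ler_sum => i _.
  rewrite mul_diag_mx !mxE normcM exprMn expr1 ler_wpM2r ?sqr_ge0//.
  rewrite /normc/= expr0n/= addr0 sqrtr_sqr ler_pXn2r ?nnegrE//.
Qed.

Lemma retr_even_ge0 d (A : 'M[C]_d) q : A \is hermsymmx -> 0 <= retr (A ^+ (2 * q)).
Proof.
move=> /hermsymmx_eigenvalues[a [-> _ _]]; apply: sumr_ge0 => i _.
by rewrite exprM exprn_ge0// sqr_ge0.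
Qed.

(** Even powers make every term of the trace nonnegative, so each eigenvalue is dominated by the
    whole sum. *)
Lemma specnorm_le_retr d (A : 'M[C]_d) q t : A \is hermsymmx -> (0 < q)%N ->
  0 <= t -> retr (A ^+ (2 * q)) <= t ^+ (2 * q) -> specnorm A <= t.
Proof.
move=> /hermsymmx_eigenvalues[a [-> _ h]] q0 t0 le; apply: h => // i.
rewrite -(@ler_pXn2r _ (2 * q)) ?muln_gt0 ?nnegrE//.
rewrite -normrX ger0_norm; last by rewrite exprM exprn_ge0// sqr_ge0.
apply: le_trans le; rewrite (bigD1 i)//= lerDl sumr_ge0// => j _.
by rewrite exprM exprn_ge0// sqr_ge0.
Qed.

Lemma retr_le_specnorm d (A : 'M[C]_d) q t : A \is hermsymmx ->
  specnorm A <= t -> retr (A ^+ (2 * q)) <= d%:R * t ^+ (2 * q).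
Proof.
move=> /hermsymmx_eigenvalues[a [-> h _]] le.
rewrite -[d in leRHS]card_ord mulr_natl -sumr_const; apply: ler_sum => i _.
rewrite exprM -real_normK ?num_real// -exprM lerXn2r ?nnegrE//.
  by rewrite (le_trans _ le)// specnorm_ge0.
exact: le_trans (h i) le.
Qed.

(** Large [q] removes the factor [d]: an eigenvalue beyond [t] would make [(|a i| / t) ^+ (2 * q)]
    outgrow it. This writes a norm ball as a countable intersection of sets cut out by polynomials
    in the entries, which is how norm events are shown measurable. *)
Lemma specnorm_leP d (A : 'M[C]_d) t : A \is hermsymmx -> 0 <= t ->
  specnorm A <= t <-> forall q, retr (A ^+ (2 * q)) <= d%:R * t ^+ (2 * q).
Proof.
move=> hA t0; split=> [le q|h]; first exact: retr_le_specnorm.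
have [a [ha _]] := hermsymmx_eigenvalues hA; apply=> // i.
have {}h q : `|a i| ^+ (2 * q) <= d%:R * t ^+ (2 * q).
  apply: le_trans (h q); rewrite ha (bigD1 i)//= -normrX ger0_norm.
    by rewrite lerDl sumr_ge0// => j _; rewrite exprM exprn_ge0// sqr_ge0.
  by rewrite exprM exprn_ge0// sqr_ge0.
rewrite leNgt; apply/negP => lt.
have t1 : 0 < t.
  rewrite lt_def t0 andbT; apply/eqP => t1; move: lt (h 1%N).
  by rewrite t1 muln1 expr0n/= mulr0 => lt; rewrite leNgt exprn_gt0.
have [q hq] : exists q, d%:R < (`|a i| / t) ^+ (2 * q).
  set r := `|a i| / t; have r1 : 1 < r by rewrite ltr_pdivlMr// mul1r.
  have r0 : 0 < r - 1 by rewrite subr_gt0.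
  have bern n : 1 + n%:R * (r - 1) <= r ^+ n.
    elim: n => [|n IH]; first by rewrite mul0r addr0 expr0.
    rewrite exprS (le_trans _ (ler_wpM2l _ IH))//; last by lra.
    rewrite -natr1; have : 0 <= n%:R * (r - 1) ^+ 2 by rewrite mulr_ge0// sqr_ge0.
    by rewrite expr2; nra.
  (* This [q] satisfies [q (r - 1) > d], so Bernoulli's inequality [bern] at exponent [2 * q]
     exceeds [d]. *)
  exists (Num.truncn (d%:R / (r - 1))).+1.
  apply: lt_le_trans (bern _).
  have := truncnS_gt (d%:R / (r - 1)); rewrite ltr_pdivrMr// => h1.
  rewrite natrM; have : 0 <= (Num.truncn (d%:R / (r - 1))).+1%:R * (r - 1).
    by rewrite mulr_ge0// ltW.
  lra.
have := h q; rewrite leNgt => /negP; apply.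
by move: hq; rewrite expr_div_n ltr_pdivlMr// exprn_gt0.
Qed.

End trace_powers.

(** * Second-order expansion of trace powers *)

Section trace_taylor.
Context (R : realType).
Local Notation C := R[i].

Lemma retrD d (A B : 'M[C]_d) : retr (A + B) = retr A + retr B.
Proof. by rewrite /retr mxtraceD cReD. Qed.

Lemma retr_sum d I (r : seq I) (Pr : pred I) (f : I -> 'M[C]_d) :
  retr (\sum_(i <- r | Pr i) f i) = \sum_(i <- r | Pr i) retr (f i).
Proof.
elim/big_ind2: _ => // [|A a B b <- <-]; first by rewrite /retr mxtrace0.
by rewrite retrD.
Qed.

Lemma retrC d (A B : 'M[C]_d) : retr (A * B) = retr (B * A).
Proof. by rewrite /retr -!mulmxE mxtrace_mulC. Qed.

(** Telescoping without commutativity, with the powers of [A] on the right; the mirror image below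
    has them on the left. At [k = 0] the sum is empty and [k.-1] is harmless. *)
Lemma expr_expansion_l (S : pzRingType) (A B : S) k :
  A ^+ k = B ^+ k + \sum_(i < k) B ^+ (k.-1 - i) * (A - B) * A ^+ i.
Proof.
elim: k => [|k IH]; first by rewrite big_ord0 addr0 !expr0.
rewrite big_ord_recr/= subnn expr0 mul1r.
rewrite [in LHS]exprS {1}(_ : A = B + (A - B)); last by rewrite addrC subrK.
rewrite mulrDl {1}IH mulrDr -exprS -!addrA; congr (_ + _).
rewrite mulr_sumr; congr (_ + _); apply: eq_bigr => i _.
by rewrite !mulrA -exprS; congr (_ ^+ _ * _ * _);
  case: k i {IH} => [[]|k i]//=; rewrite subSn// -ltnS.
Qed.

Lemma expr_expansion_r (S : pzRingType) (A B : S) k :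
  A ^+ k = B ^+ k + \sum_(i < k) A ^+ i * (A - B) * B ^+ (k.-1 - i).
Proof.
elim: k => [|k IH]; first by rewrite big_ord0 addr0 !expr0.
rewrite big_ord_recr/= subnn expr0 mulr1.
rewrite [in LHS]exprSr {2}(_ : A = B + (A - B)); last by rewrite addrC subrK.
rewrite mulrDr {1}IH mulrDl -exprSr -!addrA; congr (_ + _).
rewrite mulr_suml; congr (_ + _); apply: eq_bigr => i _.
by rewrite -!mulrA -exprSr; congr (_ * (_ * _ ^+ _));
  case: k i {IH} => [[]|k i]//=; rewrite subSn// -ltnS.
Qed.

(** The left expansion is applied to [A ^+ p], then the right one to each inner [A ^+ i]. Cyclicity
    of the trace merges the [p] first-order terms into one and gathers the two powers of [B] in each
    second-order term; the exponents of [A] and [B] there add up to [p - 2]. *)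
Lemma retr_expansion d (A B : 'M[C]_d) p :
  retr (A ^+ p) = retr (B ^+ p) + p%:R * retr (B ^+ p.-1 * (A - B)) +
    \sum_(i < p) \sum_(l < i)
      retr (B ^+ (i.-1 - l + (p.-1 - i)) * (A - B) * A ^+ l * (A - B)).
Proof.
rewrite {1}(expr_expansion_l A B p) retrD -addrA; congr (_ + _).
rewrite retr_sum -[p in p%:R]card_ord mulr_natl -sumr_const -big_split/=.
apply: eq_bigr => i _.
rewrite {1}(expr_expansion_r A B i) mulrDr retrD mulr_sumr retr_sum.
congr (_ + _).
  rewrite [LHS]retrC mulrA -exprD; congr (retr (_ ^+ _ * _)).
  by case: p i => [[]|p i]//=; rewrite subnKC// -ltnS.
by apply: eq_bigr => l _; rewrite mulrA [LHS]retrC !mulrA -exprD.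
Qed.

(** Column [b] is the image under [U D] of a unit vector. Bounding columns one at a time by the
    spectral norm avoids the factor [d] that the Frobenius norm would cost. *)
Lemma sum_normc_unitary_conj d (U W D : 'M[C]_d) b :
  U ^t* *m U = 1%:M -> W *m W ^t* = 1%:M ->
  \sum_a normc ((U *m D *m W ^t*) a b) ^+ 2 <= specnorm D ^+ 2.
Proof.
move=> hU hW; pose x : 'cV[C]_d := W ^t* *m delta_mx b 0.
have x1 : l2norm x = 1.
  rewrite l2norm_unitary; last by rewrite trmxCK.
  rewrite /l2norm (bigD1 b)//= big1 => [|k kb].
    by rewrite mxE !eqxx normc1 expr1n addr0 sqrtr1.
  by rewrite mxE (negbTE kb) normc0 expr0n.
rewrite (_ : \sum_a _ = sqnorm (U *m (D *m x))).
  rewrite -sqr_l2norm l2norm_unitary// ler_pXn2r ?nnegrE ?l2norm_ge0 ?specnorm_ge0//.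
  by rewrite -[leRHS]mulr1 -x1 l2norm_mul_le.
by rewrite /sqnorm; apply: eq_bigr => a _; rewrite /x !mulmxA -colE [col _ _ _ _]mxE.
Qed.

(** Replace the smaller of [|a|], [|b|] by the larger one; the sum on the right dominates the
    maximum. The absolute value on the left is needed since [k] and [l] may both be odd. *)
Lemma expr_mix_le (a b : R) k l q : (k + l = 2 * q)%N ->
  `|b ^+ k * a ^+ l| <= a ^+ (2 * q) + b ^+ (2 * q).
Proof.
move=> kl; rewrite normrM !normrX.
have ev (c : R) : c ^+ (2 * q) = `|c| ^+ (2 * q).
  by rewrite -normrX ger0_norm// exprM exprn_ge0// sqr_ge0.
rewrite (ev a) (ev b); have [ab|/ltW ab] := leP `|a| `|b|.
  apply: (@le_trans _ _ (`|b| ^+ (2 * q))); last by rewrite lerDr exprn_ge0.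
  by rewrite -kl exprD ler_wpM2l ?exprn_ge0// lerXn2r ?nnegrE.
apply: (@le_trans _ _ (`|a| ^+ (2 * q))); last by rewrite lerDl exprn_ge0.
by rewrite -kl exprD ler_wpM2r ?exprn_ge0// lerXn2r ?nnegrE.
Qed.

(* In eigenbases of [B] and [A] the trace becomes
   [\sum_(a, b) beta_a ^ k * alpha_b ^ l * |E_ab|^2], where [E] is [D] written
   in these two bases. *)
Lemma retr_cross_le d (A B D : 'M[C]_d) k l q s :
  A \is hermsymmx -> B \is hermsymmx -> D \is hermsymmx ->
  specnorm D <= s -> (k + l = 2 * q)%N ->
  retr (B ^+ k * D * A ^+ l * D) <=
    s ^+ 2 * (retr (A ^+ (2 * q)) + retr (B ^+ (2 * q))).
Proof.
move=> /hermsymmx_spectral[W [al [W1 W2 hA]]] /hermsymmx_spectral[U [be [U1 U2 hB]]].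
move=> /hermsymmxP hD Ds kl.
have s2 : specnorm D ^+ 2 <= s ^+ 2.
  by rewrite ler_pXn2r ?nnegrE ?specnorm_ge0// (le_trans _ Ds)// specnorm_ge0.
have trA : retr (A ^+ (2 * q)) = \sum_i al i ^+ (2 * q).
  rewrite /retr hA mxtrace_mulC mulmxA W1 mul1mx mxtrace_diag cRe_sum.
  by apply: eq_bigr => i _; rewrite mxE.
have trB : retr (B ^+ (2 * q)) = \sum_i be i ^+ (2 * q).
  rewrite /retr hB mxtrace_mulC mulmxA U1 mul1mx mxtrace_diag cRe_sum.
  by apply: eq_bigr => i _; rewrite mxE.
pose E := U *m D *m W ^t*.
have Et : E ^t* = W *m D *m U ^t*.
  by rewrite /E !trmx_mul !map_mxM hD trmxCK mulmxA.
have -> : retr (B ^+ k * D * A ^+ l * D) =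
    \sum_a \sum_b be a ^+ k * al b ^+ l * normc (E a b) ^+ 2.
  rewrite /retr hA hB -!mulmxE -!mulmxA mxtrace_mulC -!mulmxA.
  rewrite (mulmxA W) -Et (mulmxA U) (mulmxA (U *m D)) -/E; clearbody E.
  rewrite /mxtrace cRe_sum.
  apply: eq_bigr => a _; rewrite mul_diag_mx mxE mxE mul_diag_mx.
  rewrite [X in _ * X]mxE mulr_sumr cRe_sum; apply: eq_bigr => b _; rewrite !mxE.
  rewrite [X in complex.Re X](_ : _ =
    (be a ^+ k)%:C * (al b ^+ l)%:C * (E a b * (E a b)^*)); last by ring.
  by rewrite -sqr_normcE -!rmorphM.
apply: (@le_trans _ _ (\sum_a \sum_b
    (al b ^+ (2 * q) + be a ^+ (2 * q)) * normc (E a b) ^+ 2)).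
  apply: ler_sum => a _; apply: ler_sum => b _; rewrite ler_wpM2r ?sqr_ge0//.
  exact: le_trans (ler_norm _) (expr_mix_le _ _ kl).
rewrite trA trB mulrDr; 
under eq_bigr do (under eq_bigr do rewrite mulrDl; rewrite big_split/=).
(* The terms in [al b] are summed over [a], along columns of [E]; those in [be a] are summed over
   [b], along rows of [E], which are columns of its adjoint. *)
rewrite big_split/=; apply: lerD.
  rewrite exchange_big/= mulr_sumr; apply: ler_sum => b _.
  rewrite -mulr_sumr mulrC ler_wpM2r//; first by rewrite exprM exprn_ge0// sqr_ge0.
  by apply: le_trans s2; exact: sum_normc_unitary_conj.
rewrite mulr_sumr; apply: ler_sum => a _.
rewrite -mulr_sumr mulrC ler_wpM2r//; first by rewrite exprM exprn_ge0// sqr_ge0.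
apply: le_trans s2; apply: le_trans (sum_normc_unitary_conj D a W2 U1).
by apply: ler_sum => b _; rewrite -Et !mxE normc_conj.
Qed.

(** The second-order terms number [p (p - 1) / 2 = (q + 1) (2 q + 1)] for [p = 2 q + 2], and each is
    at most [K]. The first-order term is kept exactly, because it is its mean that vanishes for a
    martingale. *)
Lemma retr_step d (A B : 'M[C]_d) s q :
  A \is hermsymmx -> B \is hermsymmx -> specnorm (A - B) <= s ->
  retr (A ^+ (2 * q.+1)) <= retr (B ^+ (2 * q.+1)) +
    (2 * q.+1)%:R * retr (B ^+ (2 * q).+1 * (A - B)) +
    (q.+1 * (2 * q).+1)%:R * s ^+ 2 * (retr (A ^+ (2 * q)) + retr (B ^+ (2 * q))).
Proof.
move=> hA hB hs; rewrite (retr_expansion A B (2 * q.+1)) mulnS/=.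
rewrite lerD2l; set K := s ^+ 2 * (retr (A ^+ (2 * q)) + retr (B ^+ (2 * q))).
apply: (@le_trans _ _ (\sum_(i < 2 + 2 * q) \sum_(l < i) K)).
  apply: ler_sum => i _; apply: ler_sum => l _; apply: retr_cross_le => //.
    by rewrite hermsymmxD// hermsymmxN.
  by case: i l => [[|i]]//= hi [l/= hl]; lia.
rewrite -mulrA -/K; under eq_bigr do rewrite sumr_const card_ord -mulr_natl.
rewrite -mulr_suml -natr_sum ler_wpM2r//.
  by rewrite mulr_ge0 ?sqr_ge0// addr_ge0// retr_even_ge0.
suff -> : (\sum_(i < 2 + 2 * q) i = q.+1 * (2 * q).+1)%N by [].
elim: q {K} => [|q IH]; first by rewrite !big_ord_recr big_ord0.
rewrite (_ : 2 + 2 * q.+1 = (2 + 2 * q).+2)%N; last by lia.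
by rewrite 2!big_ord_recr/= IH; lia.
Qed.

End trace_taylor.

(** * Bounded measurable functions *)

Section bounded_measurable.
Context (R : realType) d (X : measurableType d).
Implicit Types f g : X -> R.

(** Boundedness is built in so that integrability against a finite measure is automatic. *)
Definition bmeas f : Prop :=
  measurable_fun setT f /\ exists K, forall x, `|f x| <= K.

Lemma bmeas_cst c : bmeas (fun=> c).
Proof. by split; [exact: measurable_cst|exists `|c|]. Qed.

Lemma bmeasD f g : bmeas f -> bmeas g -> bmeas (fun x => f x + g x).
Proof.
move=> [mf [K hK]] [mg [L hL]]; split; first exact: measurable_funD.
by exists (K + L) => x; rewrite (le_trans (ler_normD _ _))// lerD.
Qed.

Lemma bmeasM f g : bmeas f -> bmeas g -> bmeas (fun x => f x * g x).
Proof.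
move=> [mf [K hK]] [mg [L hL]]; split; first exact: measurable_funM.
by exists (K * L) => x; rewrite normrM ler_pM.
Qed.

Lemma bmeasZ c f : bmeas f -> bmeas (fun x => c * f x).
Proof. exact/bmeasM/bmeas_cst. Qed.

Lemma eq_bmeas f g : f =1 g -> bmeas f -> bmeas g.
Proof. by move=> /funext ->. Qed.

Lemma bmeasN f : bmeas f -> bmeas (fun x => - f x).
Proof. by move=> /(bmeasZ (-1)); apply: eq_bmeas => x; rewrite mulN1r. Qed.

Lemma bmeasB f g : bmeas f -> bmeas g -> bmeas (fun x => f x - g x).
Proof. by move=> hf /bmeasN; exact: bmeasD. Qed.

Lemma bmeas_sum I (r : seq I) (P : pred I) (F : I -> X -> R) :
  (forall i, bmeas (F i)) -> bmeas (fun x => \sum_(i <- r | P i) F i x).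
Proof.
move=> h; elim: r => [|i r IH].
  by apply: eq_bmeas (bmeas_cst 0) => x; rewrite big_nil.
have [Pi|Pi] := boolP (P i).
  by apply: eq_bmeas (bmeasD (h i) IH) => x; rewrite big_cons Pi.
by apply: eq_bmeas IH => x; rewrite big_cons (negbTE Pi).
Qed.

Lemma bmeas_indic (A : set X) : measurable A -> bmeas (\1_A : X -> R).
Proof.
move=> mA; split; first exact: measurable_indic.
by exists 1 => x; rewrite indicE; case: (_ \in _); rewrite ?normr1 ?normr0.
Qed.

Lemma measurable_bmeas_ge f c : bmeas f -> measurable [set x | c <= f x].
Proof.
move=> [mf _]; rewrite (_ : [set x | _] = f @^-1` `[c, +oo[).
  by rewrite -[X in measurable X]setTI; exact: mf.
by apply/seteqP; split=> x /=; rewrite in_itv/= andbT.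
Qed.

Lemma measurable_bmeas_le f c : bmeas f -> measurable [set x | f x <= c].
Proof.
move=> [mf _]; rewrite (_ : [set x | _] = f @^-1` `]-oo, c]).
  by rewrite -[X in measurable X]setTI; exact: mf.
by apply/seteqP; split=> x /=; rewrite in_itv/=.
Qed.

Lemma bmeas_lim f (F : nat -> X -> R) : (exists K, forall x, `|f x| <= K) ->
  (forall n, bmeas (F n)) -> (forall n x, `|f x - F n x| <= n.+1%:R^-1) -> bmeas f.
Proof.
move=> bf hF le; split=> //.
apply: (@measurable_fun_cvg _ _ _ _ F) => [n|x _]; first by case: (hF n).
apply/cvgrPdist_le => e e0.
exists (Num.truncn e^-1) => // n /= hn.
rewrite (le_trans (le n x))// invf_ple ?posrE//.
by rewrite (le_trans (ltW (truncnS_gt _)))// ler_nat.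
Qed.

Lemma sum_ltn_ord (m t : nat) : (t <= m)%N -> (\sum_(k < m) (k < t) = t)%N.
Proof.
move=> tm; rewrite -big_mkcond/= -[RHS]card_ord -sum1_card.
by rewrite (big_ord_widen _ (fun=> 1)%N tm).
Qed.

(* Layer cake: with [t = trunc ((f + K) * n)], [t = \sum_k [k.+1 <= (f + K) * n]],
   so [f] is within [n^-1] of a combination of indicators of superlevel sets. *)
Lemma bmeas_ind (Pr : (X -> R) -> Prop) :
  (forall A, measurable A -> Pr \1_A) ->
  (forall f g, bmeas f -> bmeas g -> Pr f -> Pr g -> Pr (fun x => f x + g x)) ->
  (forall c f, bmeas f -> Pr f -> Pr (fun x => c * f x)) ->
  (forall f (F : nat -> X -> R), bmeas f -> (forall n, bmeas (F n)) ->
    (forall n x, `|f x - F n x| <= n.+1%:R^-1) -> (forall n, Pr (F n)) -> Pr f) ->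
  forall f, bmeas f -> Pr f.
Proof.
move=> Pindic PD PZ Plim f bf; have [_ [K hK]] := bf.
pose A n k := [set x | k.+1%:R / n.+1%:R - K <= f x].
pose m n := Num.truncn ((K + K) * n.+1%:R).
pose G n j x := n.+1%:R^-1 * (\sum_(k < j) \1_(A n k) x) + - K * \1_[set: X] x.
have mA n k : measurable (A n k) by exact: measurable_bmeas_ge.
have bS n j : bmeas (fun x => \sum_(k < j) (\1_(A n k) x : R)).
  by apply: bmeas_sum => k; exact: bmeas_indic.
have bG n j : bmeas (G n j).
  by apply: bmeasD; [exact: bmeasZ|apply: bmeasZ; exact: bmeas_indic].
have PS n j : Pr (fun x => \sum_(k < j) (\1_(A n k) x : R)).
  elim: j => [|j IH].
    rewrite (_ : (fun _ => _) = (\1_set0 : X -> R)); first exact: Pindic.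
    by apply/funext => x; rewrite big_ord0 indicE in_set0.
  under eq_fun do rewrite big_ord_recr/=.
  by apply: PD; [exact: bS|exact: bmeas_indic|exact: IH|exact: Pindic].
apply: (Plim f (fun n => G n (m n))) => // [n x|n]; last first.
  have bT := bmeas_indic (@measurableT _ X).
  by apply: PD; [exact: bmeasZ|exact: bmeasZ|exact: PZ|apply: PZ => //; exact: Pindic].
have n0 : 0 < n.+1%:R :> R by [].
set y := (f x + K) * n.+1%:R.
have fK : 0 <= f x + K by have := hK x; rewrite ler_norml; lra.
have y0 : 0 <= y by rewrite mulr_ge0// ltW.
have tm : (Num.truncn y <= m n)%N.
  apply: le_truncn; rewrite ler_wpM2r ?ler0n// lerD2r.
  exact: le_trans (ler_norm _) (hK x).
have -> : G n (m n) x = (Num.truncn y)%:R / n.+1%:R - K.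
  rewrite /G indicE in_setT mulr1; congr (_ - _); rewrite mulrC; congr (_ * _).
  rewrite -(sum_ltn_ord tm) natr_sum; apply: eq_bigr => k _; congr (_%:R).
  rewrite truncn_gt_nat; congr nat_of_bool; apply/idP/idP.
    by rewrite inE /A/= lerBlDr ler_pdivrMr.
  by rewrite inE /A/= lerBlDr ler_pdivrMr.
have -> : f x - ((Num.truncn y)%:R / n.+1%:R - K) = (y - (Num.truncn y)%:R) / n.+1%:R.
  have ye : y / n.+1%:R = f x + K by rewrite /y mulfK ?gt_eqF.
  by rewrite mulrBl ye opprB addrA.
rewrite normrM (gtr0_norm (_ : 0 < n.+1%:R^-1)) ?invr_gt0//.
rewrite -[leRHS]mul1r ler_wpM2r ?invr_ge0 ?ler0n//.
have := truncn_itv y0; rewrite -natr1 => /andP[h1 h2].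
by rewrite ger0_norm; lra.
Qed.

End bounded_measurable.

Lemma bmeas_comp (R : realType) d d' (X : measurableType d) (Y : measurableType d')
  (f : Y -> R) (g : X -> Y) : bmeas f -> measurable_fun setT g -> bmeas (f \o g).
Proof.
by move=> [mf [K hK]] mg; split; [exact: measurableT_comp|exists K => x /=].
Qed.

Section bounded_integral.
Context (R : realType) d (X : measurableType d).
Variable mu : {finite_measure set X -> \bar R}.
Implicit Types f g : X -> R.

Lemma bmeas_integrable f : bmeas f -> mu.-integrable setT (EFin \o f).
Proof.
move=> [mf [K hK]]; apply: measurable_bounded_integrable => //.
  by rewrite -ge0_fin_numE//; exact: fin_num_measure.
exists K; split; first exact: num_real.
by move=> x Kx y _ /=; rewrite (le_trans (hK y))// ltW.
Qed.

Lemma bRintegralD f g : bmeas f -> bmeas g ->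
  \int[mu]_x (f x + g x) = \int[mu]_x f x + \int[mu]_x g x.
Proof. by move=> bf bg; rewrite RintegralD//; exact: bmeas_integrable. Qed.

Lemma bRintegralZ c f : bmeas f -> \int[mu]_x (c * f x) = c * \int[mu]_x f x.
Proof. by move=> bf; rewrite RintegralZl//; exact: bmeas_integrable. Qed.

Lemma bRintegralB f g : bmeas f -> bmeas g ->
  \int[mu]_x (f x - g x) = \int[mu]_x f x - \int[mu]_x g x.
Proof. by move=> bf bg; rewrite RintegralB//; exact: bmeas_integrable. Qed.

Lemma bRintegral_sum I (r : seq I) (P : pred I) (F : I -> X -> R) :
  (forall i, bmeas (F i)) ->
  \int[mu]_x (\sum_(i <- r | P i) F i x) = \sum_(i <- r | P i) \int[mu]_x F i x.
Proof.
move=> h; elim: r => [|i r IH].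
  rewrite big_nil; under eq_Rintegral do rewrite big_nil.
  by rewrite Rintegral_cst// mul0r.
under eq_Rintegral do rewrite big_cons.
rewrite big_cons; case: ifPn => Pi; last exact: IH.
by rewrite bRintegralD// ?IH//; exact: bmeas_sum.
Qed.

Lemma le_bRintegral f g : bmeas f -> bmeas g -> (forall x, f x <= g x) ->
  \int[mu]_x f x <= \int[mu]_x g x.
Proof. by move=> bf bg fg; apply: le_Rintegral => //; exact: bmeas_integrable. Qed.

Lemma norm_bRintegral_le f K : bmeas f -> (forall x, `|f x| <= K) ->
  `|\int[mu]_x f x| <= K * fine (mu setT).
Proof.
move=> bf hK; rewrite -(Rintegral_cst mu measurableT) ler_norml.
have bK := bmeas_cst X K; apply/andP; split.
  rewrite -mulN1r -bRintegralZ//; apply: le_bRintegral => // [|x]; first exact: bmeasZ.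
  by rewrite mulN1r; have := hK x; rewrite ler_norml => /andP[].
by apply: le_bRintegral => // x; rewrite (le_trans (ler_norm _)).
Qed.

Lemma Rintegral_indic (A : set X) : measurable A ->
  \int[mu]_x (\1_A x : R) = fine (mu A).
Proof. by move=> mA; rewrite /Rintegral integral_indic// setIT. Qed.

Lemma bRintegral_lim f (F : nat -> X -> R) : bmeas f -> (forall n, bmeas (F n)) ->
  (forall n x, `|f x - F n x| <= n.+1%:R^-1) ->
  forall n, `|\int[mu]_x f x - \int[mu]_x F n x| <= n.+1%:R^-1 * fine (mu setT).
Proof.
move=> bf bF le n; rewrite -bRintegralB//; apply: norm_bRintegral_le => //.
exact: bmeasB.
Qed.

End bounded_integral.

Lemma Rintegral_prob_cst (R : realType) d (X : measurableType d)
  (p : probability X R) (c : R) : \int[p]_x c = c.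
Proof.
rewrite Rintegral_cst// -[RHS]mulr1; congr (_ * _).
exact: (congr1 fine (@probability_setT _ _ _ p)).
Qed.

Lemma eq_of_le_inv_nat (R : realType) (a b c : R) :
  (forall n : nat, `|a - b| <= n.+1%:R^-1 * c) -> a = b.
Proof.
move=> h; apply/eqP; rewrite -subr_eq0 -normr_le0 leNgt; apply/negP => ab0.
have := h (Num.truncn (c / `|a - b|)); rewrite leNgt => /negP; apply.
rewrite mulrC ltr_pdivrMr// mulrC -ltr_pdivrMr//; exact: truncnS_gt.
Qed.

(** * Total variation as a bound on differences of integrals *)

Section total_variation_bound.
Context (R : realType) d (X : measurableType d).

(** The Jordan decomposition [p - q = jp - jn] is rewritten as [p + jn = q + jp], an identity
    between positive measures, which extends from indicators to bounded functions. Any Hahn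
    decomposition is allowed because [tv_norm] picks one by choice. *)
Lemma Rintegral_diff_le_charge_variation (p q : probability X R) P N
  (h : hahn_decomposition (prob_diff p q) P N) (f : X -> R) (K : R) :
  bmeas f -> (forall x, `|f x| <= K) ->
  `|\int[p]_x f x - \int[q]_x f x| <= K * fine (charge_variation h setT).
Proof.
move=> bf hK.
pose jp : {finite_measure set X -> \bar R} := jordan_pos h.
pose jn : {finite_measure set X -> \bar R} := jordan_neg h.
have jE A : measurable A -> fine (p A) + fine (jn A) = fine (q A) + fine (jp A).
  move=> mA; have := jordan_decomp h mA.
  rewrite /prob_diff/= /cadd/= /copp/= /cscale/=.
  have fn (nu : {finite_measure set X -> \bar R}) : (fine (nu A))%:E = nu A.
    by rewrite fineK// fin_num_measure.
  have := fn jp; have := fn jn; have := fn p; have := fn q.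
  rewrite -/jp -/jn => <- <- <- <-.
  by rewrite -EFinB -EFinM -EFinD => -[]/=; lra.
have eqI g : bmeas g -> \int[p]_x g x + \int[jn]_x g x = \int[q]_x g x + \int[jp]_x g x.
  move=> bg; apply: (bmeas_ind (Pr := fun g =>
    \int[p]_x g x + \int[jn]_x g x = \int[q]_x g x + \int[jp]_x g x)) bg.
  - by move=> A mA; rewrite !Rintegral_indic// jE.
  - by move=> f1 f2 b1 b2 e1 e2; rewrite !bRintegralD//; lra.
  - by move=> c f1 b1 e1; rewrite !bRintegralZ// -!mulrDr e1.
  - move=> f1 F b1 bF le e1.
    apply: (@eq_of_le_inv_nat _ _ _
      (fine (p setT) + fine (jn setT) + fine (q setT) + fine (jp setT))) => n.
    have := bRintegral_lim p b1 bF le n; have := bRintegral_lim q b1 bF le n.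
    have := bRintegral_lim jp b1 bF le n; have := bRintegral_lim jn b1 bF le n.
    have := e1 n; rewrite !ler_norml; set e := n.+1%:R^-1; nra.
have -> : \int[p]_x f x - \int[q]_x f x = \int[jp]_x f x - \int[jn]_x f x.
  by have := eqI _ bf; lra.
rewrite (le_trans (ler_normB _ _))//.
have -> : charge_variation h setT = (jp setT + jn setT)%E by [].
rewrite fineD ?fin_num_measure// mulrDr lerD//.
  exact: (@norm_bRintegral_le _ _ _ jp).
exact: (@norm_bRintegral_le _ _ _ jn).
Qed.

Lemma Rintegral_diff_le_tv (p q : probability X R) (f : X -> R) (K : R) :
  bmeas f -> (forall x, `|f x| <= K) ->
  `|\int[p]_x f x - \int[q]_x f x| <= K * fine (tv_norm (prob_diff p q)).
Proof. exact: Rintegral_diff_le_charge_variation. Qed.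

End total_variation_bound.

(** * Bounded measurable matrix functions and sub-sigma-algebras *)

Section matrix_bounded_measurable.
Context (R : realType) d (X : measurableType d).
Local Notation C := R[i].

Definition mbmeas m n (F : X -> 'M[C]_(m, n)) : Prop := forall i j,
  bmeas (fun x => complex.Re (F x i j)) /\ bmeas (fun x => complex.Im (F x i j)).

Lemma eq_mbmeas m n (F G : X -> 'M[C]_(m, n)) : F =1 G -> mbmeas F -> mbmeas G.
Proof. by move=> /funext ->. Qed.

Lemma mbmeas_cst m n (A : 'M[C]_(m, n)) : mbmeas (fun=> A).
Proof. by move=> i j; split; exact: bmeas_cst. Qed.

Lemma mbmeasD m n (F G : X -> 'M[C]_(m, n)) :
  mbmeas F -> mbmeas G -> mbmeas (fun x => F x + G x).
Proof.
move=> hF hG i j; have [rF iF] := hF i j; have [rG iG] := hG i j.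
split; [apply: eq_bmeas (bmeasD rF rG)|apply: eq_bmeas (bmeasD iF iG)] => x.
  by rewrite mxE cReD.
by rewrite mxE cImD.
Qed.

Lemma mbmeasN m n (F : X -> 'M[C]_(m, n)) : mbmeas F -> mbmeas (fun x => - F x).
Proof.
move=> hF i j; have [rF iF] := hF i j.
split; [apply: eq_bmeas (bmeasN rF)|apply: eq_bmeas (bmeasN iF)] => x.
  by rewrite mxE cReN.
by rewrite mxE cImN.
Qed.

Lemma mbmeasB m n (F G : X -> 'M[C]_(m, n)) :
  mbmeas F -> mbmeas G -> mbmeas (fun x => F x - G x).
Proof. by move=> hF /mbmeasN; exact: mbmeasD. Qed.

Lemma mbmeas_sum m n I (r : seq I) (P : pred I) (F : I -> X -> 'M[C]_(m, n)) :
  (forall i, P i -> mbmeas (F i)) -> mbmeas (fun x => \sum_(i <- r | P i) F i x).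
Proof.
move=> h; elim: r => [|i r IH].
  by apply: eq_mbmeas (mbmeas_cst 0) => x; rewrite big_nil.
have [Pi|Pi] := boolP (P i).
  by apply: eq_mbmeas (mbmeasD (h i Pi) IH) => x; rewrite big_cons Pi.
by apply: eq_mbmeas IH => x; rewrite big_cons (negbTE Pi).
Qed.

Lemma mbmeasM m n p (F : X -> 'M[C]_(m, n)) (G : X -> 'M[C]_(n, p)) :
  mbmeas F -> mbmeas G -> mbmeas (fun x => F x *m G x).
Proof.
move=> hF hG i j; split.
  apply: (@eq_bmeas _ _ _ (fun x => \sum_k
    (complex.Re (F x i k) * complex.Re (G x k j) -
     complex.Im (F x i k) * complex.Im (G x k j)))).
    by move=> x; rewrite mxE cRe_sum; apply: eq_bigr => k _; rewrite cReM.
  apply: bmeas_sum => k; have [rF iF] := hF i k; have [rG iG] := hG k j.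
  by apply: bmeasB; exact: bmeasM.
apply: (@eq_bmeas _ _ _ (fun x => \sum_k
  (complex.Re (F x i k) * complex.Im (G x k j) +
   complex.Im (F x i k) * complex.Re (G x k j)))).
  by move=> x; rewrite mxE cIm_sum; apply: eq_bigr => k _; rewrite cImM.
apply: bmeas_sum => k; have [rF iF] := hF i k; have [rG iG] := hG k j.
by apply: bmeasD; exact: bmeasM.
Qed.

Lemma mbmeasX n (F : X -> 'M[C]_n) k : mbmeas F -> mbmeas (fun x => F x ^+ k).
Proof.
move=> hF; elim: k => [|k IH].
  by apply: eq_mbmeas (mbmeas_cst 1%:M) => x; rewrite expr0.
by apply: eq_mbmeas (mbmeasM hF IH) => x; rewrite exprS.
Qed.

Lemma mbmeasZ m n (f : X -> R) (F : X -> 'M[C]_(m, n)) :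
  bmeas f -> mbmeas F -> mbmeas (fun x => (f x)%:C *: F x).
Proof.
move=> hf hF i j; have [rF iF] := hF i j.
split; [apply: eq_bmeas (bmeasM hf rF)|apply: eq_bmeas (bmeasM hf iF)] => x.
  by rewrite mxE cReM/= mul0r subr0.
by rewrite mxE cImM/= mul0r addr0.
Qed.

Lemma bmeas_retr n (F : X -> 'M[C]_n) : mbmeas F -> bmeas (fun x => retr (F x)).
Proof.
move=> hF; apply: (@eq_bmeas _ _ _ (fun x => \sum_i complex.Re (F x i i))).
  by move=> x; rewrite /retr /mxtrace cRe_sum.
by apply: bmeas_sum => i; case: (hF i i).
Qed.

Lemma retr_mulE n (A B : 'M[C]_n) : retr (A *m B) = \sum_i \sum_j
  (complex.Re (A i j) * complex.Re (B j i) - complex.Im (A i j) * complex.Im (B j i)).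
Proof.
rewrite /retr /mxtrace cRe_sum; apply: eq_bigr => i _.
by rewrite mxE cRe_sum; apply: eq_bigr => j _; rewrite cReM.
Qed.

End matrix_bounded_measurable.

Section sub_sigma_algebra.
Context (R : realType) d (X : measurableType d) (G : set (set X)).
Hypothesis Gmeas : G `<=` measurable.

Lemma measurable_g_sigma (A : set X) : <<s G >> A -> measurable A.
Proof.
apply: smallest_sub => //; exact: sigma_algebra_measurable.
Qed.

(** The carrier of [g_sigma_algebraType G] is [X] itself, so measurability with respect to a smaller
    sigma-algebra is expressed by retyping a function, and this lemma forgets it. *)
Lemma bmeas_g_sigma (f : g_sigma_algebraType G -> R) : bmeas f ->
  bmeas (f : X -> R).
Proof.
move=> [mf bf]; split=> // _ B mB; apply: measurable_g_sigma.
exact: mf.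
Qed.

Lemma mbmeas_g_sigma m n (F : g_sigma_algebraType G -> 'M[R[i]]_(m, n)) :
  mbmeas F -> mbmeas (F : X -> 'M[R[i]]_(m, n)).
Proof. by move=> hF i j; have [r c] := hF i j; split; exact: bmeas_g_sigma. Qed.

End sub_sigma_algebra.

(** * Matrix martingales *)

(** These are the two leading terms of the binomial expansion; the inequality closes the induction
    on time in [moment_le_prod]. *)
Lemma expr_succ_ge (R : realDomainType) (x : R) n : 0 <= x ->
  x ^+ n.+1 + n.+1%:R * x ^+ n <= (x + 1) ^+ n.+1.
Proof.
move=> x0; elim: n => [|n IH]; first by rewrite !expr1 expr0 mulr1.
rewrite [leRHS]exprSr (le_trans _ (ler_wpM2r _ IH)) ?addr_ge0//.
rewrite -[n.+2%:R]natr1 (exprSr x n.+1) (exprSr x n).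
have := exprn_ge0 n x0; move: (x ^+ n) => y y0.
have : 0 <= n.+1%:R * y by rewrite mulr_ge0.
by move: (n.+1%:R) => k; nra.
Qed.

Section moments.
Context (R : realType) dO (O : measurableType dO) (P : probability O R) (n : nat).
Local Notation C := R[i].
Variables (G : nat -> set (set O)) (D : nat -> O -> 'M[C]_n) (s : R).

(** [G i] is a generating family of the past available before difference [i]. Measurability of [D i]
    for every later [G j] stands in for a monotone filtration, and orthogonality to all bounded
    [phi] of the past encodes zero conditional expectation. *)
Definition martingale_differences : Prop :=
  [/\ forall i, G i `<=` measurable,
      forall i j, (i < j)%N -> mbmeas (D i : g_sigma_algebraType (G j) -> _),
      forall i w, D i w \is hermsymmx,
      forall i w, specnorm (D i w) <= s &
      forall i (phi : g_sigma_algebraType (G i) -> R) a b, bmeas phi ->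
        \int[P]_w (phi w * complex.Re (D i w a b)) = 0 /\
        \int[P]_w (phi w * complex.Im (D i w a b)) = 0].

Definition mart k (w : O) := \sum_(j < k) D j w.

Hypothesis hD : martingale_differences.

Lemma mart_herm k w : mart k w \is hermsymmx.
Proof. by case: hD => _ _ h _ _; exact: hermsymmx_sum. Qed.

Lemma mart_mbmeas_g k i : (k <= i)%N ->
  mbmeas (mart k : g_sigma_algebraType (G i) -> _).
Proof.
case: hD => _ h _ _ _ ki; apply: mbmeas_sum => -[j jk] _ /=.
exact/h/(leq_trans jk).
Qed.

Lemma diff_mbmeas i : mbmeas (D i).
Proof.
case: hD => hG h _ _ _; apply: (mbmeas_g_sigma (hG i.+1)); exact: h.
Qed.

Lemma mart_mbmeas k : mbmeas (mart k).
Proof. by apply: mbmeas_sum => i _; exact: diff_mbmeas. Qed.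

Definition moment q k := \int[P]_w retr (mart k w ^+ (2 * q)).

(** The entries of [mart k w ^+ p] are bounded functions of the past, hence admissible [phi] for the
    entries of [D k]. *)
Lemma Rintegral_retr_mul_diff k p : \int[P]_w retr (mart k w ^+ p *m D k w) = 0.
Proof.
have [hG _ _ _ h0] := hD.
pose f a b w := complex.Re ((mart k w ^+ p) a b) * complex.Re (D k w b a) -
  complex.Im ((mart k w ^+ p) a b) * complex.Im (D k w b a).
have X a b := mbmeasX p (mart_mbmeas_g (leqnn k)) a b.
have XO a b := mbmeasX p (mart_mbmeas k) a b.
have f1 a b : bmeas (fun w => complex.Re ((mart k w ^+ p) a b) * complex.Re (D k w b a)).
  by apply: bmeasM; [case: (XO a b)|case: (diff_mbmeas k b a)].
have f2 a b : bmeas (fun w => complex.Im ((mart k w ^+ p) a b) * complex.Im (D k w b a)).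
  by apply: bmeasM; [case: (XO a b)|case: (diff_mbmeas k b a)].
have bf a b : bmeas (f a b) by exact: bmeasB.
under eq_Rintegral do rewrite retr_mulE.
rewrite (bRintegral_sum P) => [|a]; last by apply: bmeas_sum => b; exact: bf.
apply: big1 => a _; rewrite (bRintegral_sum P) => [|b]; last exact: bf.
apply: big1 => b _; rewrite (bRintegralB P)//.
have [r i] := X a b.
by rewrite (h0 k _ b a r).1 (h0 k _ b a i).2 subr0.
Qed.

Lemma moment0 k : moment 0 k = n%:R.
Proof.
rewrite /moment; transitivity (\int[P]_w (n%:R : R)).
  by apply: eq_Rintegral => w _; rewrite expr0 /retr mxtrace1 -(rmorph_nat (real_complex R)).
exact: Rintegral_prob_cst.
Qed.

Lemma momentS0 q : moment q.+1 0 = 0.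
Proof.
rewrite /moment; transitivity (\int[P]_w (0 : R)).
  by apply: eq_Rintegral => w _; rewrite /mart big_ord0 mulnS expr0n/= /retr mxtrace0.
by rewrite Rintegral_cst// mul0r.
Qed.

Lemma moment_rec q k : moment q.+1 k.+1 <= moment q.+1 k +
  (q.+1 * (2 * q).+1)%:R * s ^+ 2 * (moment q k.+1 + moment q k).
Proof.
have [_ _ hH hs _] := hD.
have bS j p : bmeas (fun w => retr (mart j w ^+ p)).
  by apply: bmeas_retr; apply: mbmeasX; exact: mart_mbmeas.
have bT : bmeas (fun w => retr (mart k w ^+ (2 * q).+1 *m D k w)).
  apply: bmeas_retr; apply: mbmeasM; last exact: diff_mbmeas.
  by apply: mbmeasX; exact: mart_mbmeas.
have DE w : mart k.+1 w - mart k w = D k w.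
  by rewrite /mart big_ord_recr/= addrAC subrr add0r.
have step w := @retr_step _ _ (mart k.+1 w) (mart k w) s q (mart_herm _ _) (mart_herm _ _).
have bR : bmeas (fun w => retr (mart k w ^+ (2 * q.+1)) +
    (2 * q.+1)%:R * retr (mart k w ^+ (2 * q).+1 *m D k w) +
    (q.+1 * (2 * q).+1)%:R * s ^+ 2 *
      (retr (mart k.+1 w ^+ (2 * q)) + retr (mart k w ^+ (2 * q)))).
  by apply: bmeasD; [apply: bmeasD => //; exact: bmeasZ|apply: bmeasZ; exact: bmeasD].
apply: (le_trans (le_bRintegral P (bS _ _) bR _)) => [w|].
  by rewrite -(DE w) mulmxE; apply: step; rewrite DE.
rewrite (bRintegralD P); [|by apply: bmeasD => //; exact: bmeasZ|by apply: bmeasZ; exact: bmeasD].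
rewrite (bRintegralD P)//; last exact: bmeasZ.
rewrite !(bRintegralZ P)//; last exact: bmeasD.
by rewrite Rintegral_retr_mul_diff mulr0 addr0 (bRintegralD P).
Qed.

(** Induction on [q], then on [k]. The new factor [2 (2 q + 1)] of the product is what the recursion
    brings in, with 2 for the two moments of order [q]. The shift [k + q] closes the step: with
    [x = k + q + 1], both lower moments are bounded through [x], and [x^(q+1) + (q+1) x^q] is at
    most [(x + 1)^(q+1)]. *)
Lemma moment_le_prod q k : moment q k <=
  n%:R * \prod_(i < q) (2 * (2 * i).+1)%:R * (s ^+ 2 * (k + q)%:R) ^+ q.
Proof.
elim: q k => [|q IH] k; first by rewrite moment0 big_ord0 expr0 !mulr1.
elim: k => [|k IHk].
  rewrite momentS0 mulr_ge0//; last by rewrite exprn_ge0// mulr_ge0// sqr_ge0.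
  by rewrite mulr_ge0// prodr_ge0.
apply: (le_trans (moment_rec q k)).
have IH1 := IH k.+1; have IH0 := IH k.
rewrite big_ord_recr/= natrM in IHk *.
set c := \prod_(i < q) _ in IH1 IH0 IHk *.
have c0 : 0 <= c by apply: prodr_ge0.
set x : R := (k + q.+1)%:R.
have x0 : 0 <= x by rewrite ler0n.
have key := expr_succ_ge q x0.
have e1 : (k.+1 + q)%:R = x by rewrite /x addSnnS.
have e0 : (k + q)%:R <= x by rewrite ler_nat leq_add2l.
have e2 : (k.+1 + q.+1)%:R = x + 1 by rewrite /x addSn -natr1.
rewrite e1 in IH1; rewrite e2.
have {}IH0 : moment q k <= n%:R * c * (s ^+ 2 * x) ^+ q.
  apply: (le_trans IH0); rewrite ler_wpM2l ?mulr_ge0//.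
  have le : s ^+ 2 * (k + q)%:R <= s ^+ 2 * x by rewrite ler_wpM2l ?sqr_ge0.
  by apply: lerXn2r le; rewrite nnegrE mulr_ge0 ?sqr_ge0.
rewrite -/x in IHk.
have := sqr_ge0 s; move: (s ^+ 2) IH0 IH1 IHk => a IH0 IH1 IHk a0.
rewrite !exprMn in IH0 IH1 IHk *.
set u := (2 * q).+1%:R in IHk *.
have u0 : 0 <= u by rewrite ler0n.
have step : (q.+1 * (2 * q).+1)%:R * a * (moment q k.+1 + moment q k) <=
    q.+1%:R * u * a * (2 * (n%:R * c * (a ^+ q * x ^+ q))).
  rewrite natrM ler_wpM2l ?mulr_ge0// mulr_natl mulr2n.
  exact (lerD IH1 IH0).
apply: (le_trans (lerD IHk step)).
have -> : n%:R * (c * (2 * u)) * (a ^+ q.+1 * x ^+ q.+1) +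
  q.+1%:R * u * a * (2 * (n%:R * c * (a ^+ q * x ^+ q))) =
  n%:R * (c * (2 * u)) * a ^+ q.+1 * (x ^+ q.+1 + q.+1%:R * x ^+ q).
  by rewrite (exprS a); ring.
rewrite [leRHS]mulrA ler_wpM2l// !mulr_ge0 ?exprn_ge0//.
Qed.

(** The product is [2^q (2q - 1)!!], here bounded factor by factor by [(4 q)^q]. *)
Lemma moment_le q k : moment q k <=
  n%:R * (4 * q%:R * (s ^+ 2 * (k + q)%:R)) ^+ q.
Proof.
apply: (le_trans (moment_le_prod q k)); rewrite [in leRHS]exprMn [leRHS]mulrA.
apply: ler_wpM2r; first by rewrite exprn_ge0// mulr_ge0// sqr_ge0.
rewrite ler_wpM2l//.
rewrite -natrM (_ : _ ^+ q = \prod_(i < q) (4 * q)%:R); last first.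
  by rewrite prodr_const card_ord.
by apply: ler_prod => -[i iq] _; rewrite ler0n ler_nat/=; lia.
Qed.

End moments.

(** * Maximal inequality by stopping *)

Section maximal_inequality.
Context (R : realType) dO (O : measurableType dO) (P : probability O R) (n : nat).
Local Notation C := R[i].
Variables (G : nat -> set (set O)) (D : nat -> O -> 'M[C]_n) (s : R).
Hypothesis hD : martingale_differences P G D s.
Variables (q : nat) (t : R).

(** Exit is tested on the trace power, which is a polynomial in the entries and so visibly
    measurable for the past, and which for [q > 0] and [t >= 0] controls the spectral norm by
    [specnorm_le_retr]. *)
Definition trace_below k : set O :=
  [set w | retr (mart D k w ^+ (2 * q)) <= t ^+ (2 * q)].

Definition trace_below_upto k : set O := \bigcap_(j in `I_k.+1) trace_below j.

(* The martingale stopped when it leaves the ball: being out of the ball at some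
   time up to [k] is being out of the ball at time [k] for the stopped one, which
   makes Doob's inequality unnecessary. *)
Definition stopped_diff k w : 'M[C]_n := (\1_(trace_below_upto k) w : R)%:C *: D k w.

Lemma measurable_trace_below_upto_g k i : (k <= i)%N ->
  measurable (trace_below_upto k : set (g_sigma_algebraType (G i))).
Proof.
move=> ki; apply: fin_bigcap_measurable; first exact: finite_II.
move=> j /= jk.
apply: (@measurable_bmeas_le R _ (g_sigma_algebraType (G i))).
apply: bmeas_retr; apply: mbmeasX; apply: (mart_mbmeas_g hD).
exact: leq_trans ki.
Qed.

Lemma measurable_trace_below_upto k : measurable (trace_below_upto k).
Proof.
have [hG _ _ _ _] := hD.
apply: (measurable_g_sigma (hG k)); exact: (measurable_trace_below_upto_g (leqnn k)).
Qed.

(** The indicator at index [i] involves only differences of index below [i], so it can be absorbed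
    into the test function [phi]. *)
Lemma stopped_martingale_differences : martingale_differences P G stopped_diff s.
Proof.
have [hG ha hH hs h0] := hD; split; first exact: hG.
- move=> i j ij; apply: (@mbmeasZ R _ (g_sigma_algebraType (G j))); last exact: ha.
  by apply: bmeas_indic; apply: measurable_trace_below_upto_g; exact: ltnW.
- move=> i w; rewrite /stopped_diff indicE; case: (_ \in _); first by rewrite scale1r.
  by rewrite scale0r hermsymmx0.
- move=> i w; rewrite /stopped_diff indicE; case: (_ \in _); first by rewrite scale1r.
  by rewrite scale0r specnorm0; exact: le_trans (specnorm_ge0 _) (hs i w).
- move=> i phi a b bphi.
  have := h0 i (fun w => phi w * \1_(trace_below_upto i) w) a b.
  case=> [|h1 h2].
    by apply: bmeasM => //; apply: bmeas_indic; exact: measurable_trace_below_upto_g.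
  split; [rewrite -[RHS]h1|rewrite -[RHS]h2]; apply: eq_Rintegral => w _; rewrite mxE.
    by rewrite cReM/= mul0r subr0 mulrA.
  by rewrite cImM/= mul0r addr0 mulrA.
Qed.

Lemma trace_below_uptoP k w : trace_below_upto k w <->
  forall j, (j <= k)%N -> retr (mart D j w ^+ (2 * q)) <= t ^+ (2 * q).
Proof. by split=> h j jk; apply: (h j). Qed.

(** Let [k] be the first exit time. Differences of index below [k] are kept, including the one that
    causes the exit, and those from [k] on are killed, so the stopped martingale at time [m] equals
    the original one at time [k]. *)
Lemma stopped_mart_exceeds m w : ~ trace_below_upto m w ->
  t ^+ (2 * q) <= retr (mart stopped_diff m w ^+ (2 * q)).
Proof.
move=> /trace_below_uptoP out.
have /existsNP[j /not_implyP[jm /negP]] : ~ forall j, (j <= m)%N ->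
  retr (mart D j w ^+ (2 * q)) <= t ^+ (2 * q) by [].
rewrite -ltNge => jt.
pose p k := (k <= m)%N && (t ^+ (2 * q) < retr (mart D k w ^+ (2 * q))).
have ex : exists k, p k by exists j; rewrite /p jm.
have [k /andP[km kt] kmin] := ex_minnP ex.
suff -> : mart stopped_diff m w = mart D k w by exact: ltW.
rewrite /mart -!(big_mkord xpredT (fun j => _ j w)) (big_cat_nat _ (n := k))//=.
rewrite [X in _ + X]big_nat_cond [X in _ + X]big1 => [|i /andP[/andP[ki im] _]]; last first.
  rewrite /stopped_diff indicE memNset ?scale0r// => /trace_below_uptoP/(_ k ki).
  by rewrite leNgt kt.
rewrite addr0; apply: eq_big_nat => i /andP[_ ik].
rewrite /stopped_diff indicE mem_set ?scale1r//; apply/trace_below_uptoP => l li.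
rewrite leNgt; apply/negP => lt.
have := kmin l; rewrite /p lt andbT => /(_ (leq_trans li (ltnW (leq_trans ik km)))).
by rewrite leqNgt (leq_ltn_trans li ik).
Qed.

Lemma martingale_maximal_tail m :
  t ^+ (2 * q) * fine (P (~` trace_below_upto m)) <=
  n%:R * (4 * q%:R * (s ^+ 2 * (m + q)%:R)) ^+ q.
Proof.
have hS := stopped_martingale_differences.
have mE := measurableC (measurable_trace_below_upto m).
apply: le_trans (moment_le hS q m).
rewrite -(Rintegral_indic P mE) -(bRintegralZ P); last exact: bmeas_indic.
apply: le_bRintegral => [||w]; first by apply: bmeasZ; exact: bmeas_indic.
  by apply: bmeas_retr; apply: mbmeasX; exact: (mart_mbmeas hS).
have [wE|wE] := pselect (trace_below_upto m w).
  rewrite indicE memNset ?mulr0; first exact: (retr_even_ge0 _ (mart_herm hS _ _)).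
  exact.
rewrite indicE mem_set// mulr1; exact: stopped_mart_exceeds.
Qed.

End maximal_inequality.

(** * Markov chains *)

Section bounded_operators.
Context (R : realType).

(** Bounded linear operators on bounded functions. The last clause is continuity for uniform limits,
    so two integrated operators that agree on indicators agree everywhere; composition,
    multiplication, kernels and retyping to a smaller sigma-algebra are all instances. *)
Definition boperator d1 (X : measurableType d1) d2 (Y : measurableType d2)
    (A : (X -> R) -> Y -> R) : Prop :=
  [/\ forall f, bmeas f -> bmeas (A f),
      forall f g, bmeas f -> bmeas g -> forall y, A (fun x => f x + g x) y = A f y + A g y,
      forall c f, bmeas f -> forall y, A (fun x => c * f x) y = c * A f y &
      exists C, forall f K, bmeas f -> (forall x, `|f x| <= K) ->
        forall y, `|A f y| <= K * C].

Lemma boperator_eq d (X : measurableType d) d1 (Y1 : measurableType d1)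
    d2 (Y2 : measurableType d2) (mu1 : {finite_measure set Y1 -> \bar R})
    (mu2 : {finite_measure set Y2 -> \bar R})
    (A1 : (X -> R) -> Y1 -> R) (A2 : (X -> R) -> Y2 -> R) :
  boperator A1 -> boperator A2 ->
  (forall B, measurable B -> \int[mu1]_y A1 \1_B y = \int[mu2]_y A2 \1_B y) ->
  forall f, bmeas f -> \int[mu1]_y A1 f y = \int[mu2]_y A2 f y.
Proof.
move=> [b1 D1 Z1 [C1 h1]] [b2 D2 Z2 [C2 h2]] ind.
apply: bmeas_ind => //.
- move=> f g bf bg ef eg.
  transitivity (\int[mu1]_y (A1 f y + A1 g y)); first by apply: eq_Rintegral => y _; exact: D1.
  transitivity (\int[mu2]_y (A2 f y + A2 g y)); last by apply: eq_Rintegral => y _; rewrite D2.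
  by rewrite (bRintegralD mu1) ?(bRintegralD mu2) ?ef ?eg//; auto.
- move=> c f bf ef.
  transitivity (\int[mu1]_y (c * A1 f y)); first by apply: eq_Rintegral => y _; exact: Z1.
  transitivity (\int[mu2]_y (c * A2 f y)); last by apply: eq_Rintegral => y _; rewrite Z2.
  by rewrite (bRintegralZ mu1) ?(bRintegralZ mu2) ?ef//; auto.
- move=> f F bf bF le e.
  apply: (@eq_of_le_inv_nat _ _ _ (C1 * fine (mu1 setT) + C2 * fine (mu2 setT))) => n.
  (* The difference [f - F n] is written with a sum and a scaling, the two operations that the
     operators are known to respect. *)
  have bFN x : `|-1 * F n x + f x| <= n.+1%:R^-1 by rewrite mulN1r addrC.
  have bFn := bF n; have bN := bmeasZ (-1) bFn.
  have bd := bmeasD bN bf.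
  have f1 := b1 _ bf; have F1 := b1 _ (bF n); have Z1F := bmeasZ (-1) F1.
  have f2 := b2 _ bf; have F2 := b2 _ (bF n); have Z2F := bmeasZ (-1) F2.
  have := norm_bRintegral_le mu1 (b1 _ bd) (h1 _ _ bd bFN).
  have := norm_bRintegral_le mu2 (b2 _ bd) (h2 _ _ bd bFN).
  have -> : \int[mu1]_y A1 (fun x => -1 * F n x + f x) y =
      - (\int[mu1]_y A1 (F n) y) + \int[mu1]_y A1 f y.
    transitivity (\int[mu1]_y (-1 * A1 (F n) y + A1 f y)).
      by apply: eq_Rintegral => y _; rewrite D1// Z1.
    by rewrite (bRintegralD mu1) ?(bRintegralZ mu1) ?mulN1r.
  have -> : \int[mu2]_y A2 (fun x => -1 * F n x + f x) y =
      - (\int[mu2]_y A2 (F n) y) + \int[mu2]_y A2 f y.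
    transitivity (\int[mu2]_y (-1 * A2 (F n) y + A2 f y)).
      by apply: eq_Rintegral => y _; rewrite D2// Z2.
    by rewrite (bRintegralD mu2) ?(bRintegralZ mu2) ?mulN1r.
  rewrite -e mulrDr !mulrA !ler_norml.
  by move: (n.+1%:R^-1 * C1 * _) (n.+1%:R^-1 * C2 * _) => u v; lra.
Qed.

Lemma boperator_id d (X : measurableType d) : boperator (fun f : X -> R => f).
Proof. by split=> //; exists 1 => f K _ h y; rewrite mulr1. Qed.

Lemma boperator_comp d1 (X : measurableType d1) d2 (Y : measurableType d2)
    (g : Y -> X) : measurable_fun setT g -> boperator (fun f : X -> R => f \o g).
Proof.
move=> mg; split=> //; first by move=> f bf; exact: bmeas_comp.
by exists 1 => f K _ h y; rewrite mulr1/=.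
Qed.

Lemma boperator_mul d1 (X : measurableType d1) d2 (Y : measurableType d2)
    (phi : Y -> R) (A : (X -> R) -> Y -> R) : bmeas phi -> boperator A ->
  boperator (fun f y => phi y * A f y).
Proof.
move=> bphi [bA DA ZA [C hC]]; split.
- by move=> f bf; apply: bmeasM => //; exact: bA.
- by move=> f g bf bg y; rewrite DA// mulrDr.
- by move=> c f bf y; rewrite ZA// mulrCA.
- have [_ [L hL]] := bphi; exists (C * L) => f K bf hK y.
  by rewrite normrM mulrC mulrA ler_pM// hC.
Qed.

Lemma boperator_trans d1 (X : measurableType d1) d2 (Y : measurableType d2)
    d3 (W : measurableType d3) (A : (X -> R) -> Y -> R) (B : (Y -> R) -> W -> R) :
  boperator A -> boperator B -> boperator (fun f => B (A f)).
Proof.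
move=> [bA DA ZA [C hC]] [bB DB ZB [L hL]]; split.
- by move=> f bf; exact/bB/bA.
- move=> f g bf bg w; rewrite -DB; [|exact: bA|exact: bA].
  by congr (B _ w); apply/funext => y; rewrite DA.
- move=> c f bf w; rewrite -ZB; last exact: bA.
  by congr (B _ w); apply/funext => y; rewrite ZA.
- by exists (C * L) => f K bf hK w; rewrite mulrA; apply: hL; [exact: bA|exact: hC].
Qed.

End bounded_operators.

Section kernel_operator.
Context (R : realType) d (T : measurableType d).
Implicit Types (Q : R.-pker T ~> T) (f : T -> R).

Definition kop Q f (z : T) : R := \int[kprob_at Q z]_y f y.

Lemma kop_le Q f K : bmeas f -> (forall x, `|f x| <= K) -> forall z, `|kop Q f z| <= K.
Proof.
move=> bf hK z; apply: (le_trans (norm_bRintegral_le (kprob_at Q z) bf hK)).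
by rewrite (congr1 fine (@probability_setT _ _ _ (kprob_at Q z))) mulr1.
Qed.

Lemma kop_indic Q (A : set T) z : measurable A -> kop Q \1_A z = fine (Q z A).
Proof. exact: (@Rintegral_indic _ _ _ (kprob_at Q z)). Qed.

Lemma bmeas_kop Q f : bmeas f -> bmeas (kop Q f).
Proof.
move: f; apply: bmeas_ind.
- move=> A mA; split.
    rewrite (_ : kop Q \1_A = fine \o Q ^~ A); last by apply/funext => z; rewrite kop_indic.
    by apply: measurableT_comp => //; exact: measurable_kernel.
  exists 1; apply: kop_le; first exact: bmeas_indic.
  by move=> x; rewrite indicE; case: (_ \in _); rewrite ?normr1 ?normr0.
- move=> f g bf bg h1 h2; apply: eq_bmeas (bmeasD h1 h2) => z.
  by rewrite /kop (bRintegralD (kprob_at Q z)).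
- move=> c f bf h; apply: eq_bmeas (bmeasZ c h) => z.
  by rewrite /kop (bRintegralZ (kprob_at Q z)).
- move=> f F bf bF le h; apply: (@bmeas_lim _ _ _ _ (fun n => kop Q (F n))) => //.
    by have [_ [K hK]] := bf; exists K; exact: kop_le.
  move=> n z; have := bRintegral_lim (kprob_at Q z) bf bF le n.
  by rewrite (congr1 fine (@probability_setT _ _ _ (kprob_at Q z))) mulr1.
Qed.

Lemma boperator_kop Q : boperator (kop Q).
Proof.
split; first by move=> f; exact: bmeas_kop.
- by move=> f g bf bg z; rewrite /kop (bRintegralD (kprob_at Q z)).
- by move=> c f bf z; rewrite /kop (bRintegralZ (kprob_at Q z)).
- by exists 1 => f K bf hK z; rewrite mulr1; exact: kop_le.
Qed.

(** Chapman-Kolmogorov for functions. [kiter] appends the new factor [Q] last, so the induction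
    peels off the innermost application of [kop Q]. *)
Lemma kop_kiter Q n f : bmeas f -> kop (kiter Q n) f = iter n (kop Q) f.
Proof.
elim: n f => [|n IH] f bf; apply/funext => z.
  rewrite /= /kop; move: f bf.
  (* Integration against the Dirac mass is compared with evaluation at [z], regarded as an operator
     with constant values. *)
  have h := @boperator_eq R d T d T d T (kprob_at (kiter Q 0) z) (kprob_at (kiter Q 0) z)
    (fun f => f) (fun f _ => f z) (boperator_id R T).
  move=> f bf; rewrite h//; first exact: Rintegral_prob_cst.
  + split=> //; first by move=> g bg; exact: bmeas_cst.
    by exists 1 => g K _ hK y; rewrite mulr1.
  + move=> B mB; rewrite (Rintegral_indic (kprob_at (kiter Q 0) z))//.
    by rewrite (Rintegral_prob_cst (kprob_at (kiter Q 0) z)).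
rewrite iterSr -IH; last exact: bmeas_kop.
rewrite /kop; apply: (@boperator_eq R d T d T d T (kprob_at (kiter Q n.+1) z)
  (kprob_at (kiter Q n) z) (fun f => f) (kop Q)) => //.
- exact: boperator_id.
- exact: boperator_kop.
move=> B mB; rewrite (Rintegral_indic (kprob_at (kiter Q n.+1) z))//.
rewrite /Rintegral; congr fine; apply: eq_integral => y _.
have fQ : Q y B \is a fin_num := fin_num_measure (kprob_at Q y) B mB.
by rewrite kop_indic// fineK.
Qed.

End kernel_operator.

(** * The Markov property for bounded functions *)

Section chain.
Context (R : realType) dT (T : measurableType dT) dO (O : measurableType dO).
Context (Q : R.-pker T ~> T) (xi : probability T R) (P : probability O R).
Variable Z : nat -> O -> T.
Hypothesis mc : markov_chain Q xi P Z.

(** The generators of [past Z n], kept apart because [g_sigma_algebraType] takes a generating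
    family. *)
Definition past_gen n : set (set O) :=
  [set B | exists k, exists2 A, (k <= n)%N /\ measurable A & B = Z k @^-1` A].

Lemma past_gen_measurable n : past_gen n `<=` measurable.
Proof.
move=> _ [k [A [_ mA] ->]]; have [mZ _ _] := mc.
by rewrite -[X in measurable X]setTI; exact: mZ.
Qed.

Lemma past_gen_le m n : (m <= n)%N -> past_gen m `<=` past_gen n.
Proof.
by move=> mn _ [k [A [km mA] ->]]; exists k, A => //; rewrite (leq_trans km).
Qed.

Lemma measurable_state_past k n : (k <= n)%N ->
  measurable_fun setT (Z k : g_sigma_algebraType (past_gen n) -> T).
Proof.
move=> kn _ A mA; rewrite setTI; apply: sub_sigma_algebra.
by exists k, A.
Qed.

Lemma bmeas_past_le m n (f : O -> R) : (m <= n)%N ->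
  bmeas (f : g_sigma_algebraType (past_gen m) -> R) ->
  bmeas (f : g_sigma_algebraType (past_gen n) -> R).
Proof.
move=> mn [mf bf]; split=> // _ B mB.
exact: (sub_sigma_algebra2 (past_gen_le mn) (mf measurableT B mB)).
Qed.

Lemma boperator_past n :
  boperator (fun f : g_sigma_algebraType (past_gen n) -> R => (f : O -> R)).
Proof.
split=> //; last by exists 1 => f K _ h y; rewrite mulr1.
by move=> f; apply: bmeas_g_sigma; exact: past_gen_measurable.
Qed.

(** The definition of a chain gives the case of two indicators. It is extended in [u] with [phi]
    fixed and, for [u] an indicator, in [phi] over functions measurable for the past. *)
Lemma markov_bmeas n (phi : O -> R) (u : T -> R) :
  bmeas (phi : g_sigma_algebraType (past_gen n) -> R) -> bmeas u ->
  \int[P]_w (phi w * u (Z n.+1 w)) = \int[P]_w (phi w * kop Q u (Z n w)).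
Proof.
have [mZ _ mk] := mc; move=> bphi bu.
have bphi' : bmeas phi by apply: bmeas_g_sigma bphi; exact: past_gen_measurable.
have o1 : boperator (fun (f : T -> R) w => phi w * f (Z n.+1 w)).
  exact: (boperator_mul bphi' (boperator_comp R (mZ n.+1))).
have o2 : boperator (fun (f : T -> R) w => phi w * kop Q f (Z n w)).
  exact: (boperator_mul bphi' (boperator_trans (boperator_kop Q) (boperator_comp R (mZ n)))).
apply: (boperator_eq (mu1 := P) (mu2 := P) o1 o2) bu => A mA.
have bA : bmeas (fun w => \1_A (Z n.+1 w) : R).
  by apply: (bmeas_comp _ (mZ n.+1)); exact: bmeas_indic.
have bQ : bmeas (fun w => kop Q \1_A (Z n w)).
  by apply: (bmeas_comp _ (mZ n)); apply: bmeas_kop; exact: bmeas_indic.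
have mulC (f g : O -> R) : \int[P]_w (f w * g w) = \int[P]_w (g w * f w).
  by apply: eq_Rintegral => w _; rewrite mulrC.
rewrite (mulC phi (fun w => \1_A (Z n.+1 w))) (mulC phi (fun w => kop Q \1_A (Z n w))).
have p1 := boperator_mul bA (boperator_past n).
have p2 := boperator_mul bQ (boperator_past n).
apply: (boperator_eq (mu1 := P) (mu2 := P) p1 p2) bphi => B mB.
have mB' : dO.-measurable (B : set O) by exact: (measurable_g_sigma (@past_gen_measurable n) mB).
have mZA : measurable (Z n.+1 @^-1` A) by rewrite -[X in measurable X]setTI; exact: mZ.
transitivity (fine (P (B `&` Z n.+1 @^-1` A))).
  rewrite -(Rintegral_indic P); last exact: measurableI.
  by apply: eq_Rintegral => w _; rewrite indicI mulrC.
rewrite (mk n A B mA mB) integral_mkcond /Rintegral; congr fine.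
apply: eq_integral => w _; rewrite patchE indicE kop_indic//.
have fQ : Q (Z n w) A \is a fin_num := fin_num_measure (kprob_at Q (Z n w)) A mA.
by case: ifPn => _; rewrite ?mulr1 ?mulr0 ?fineK.
Qed.

End chain.

(** * Matrix integrals, the kernel acting on matrix functions, and mixing *)

Section matrix_integral.
Context (R : realType) d (T : measurableType d) (n : nat).
Local Notation C := R[i].

Lemma mxintegral_herm (mu : {finite_measure set T -> \bar R}) (F : T -> 'M[C]_n) :
  mbmeas F -> (forall z, F z \is hermsymmx) -> mxintegral mu F \is hermsymmx.
Proof.
move=> bF hF; apply/hermsymmxP/matrixP => i j; rewrite !mxE.
have Fij z : F z i j = (F z j i)^* by rewrite -{1}(hermsymmxP _ (hF z)) !mxE.
apply/eqP; rewrite eq_complex cRe_conj cIm_conj /=; apply/andP; split; apply/eqP.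
  by apply: eq_Rintegral => z _; rewrite Fij cRe_conj.
rewrite -mulN1r -(bRintegralZ mu); last by case: (bF j i).
by apply: eq_Rintegral => z _; rewrite Fij cIm_conj mulN1r.
Qed.

Lemma Re_dotE (A : 'M[C]_n) (x y : 'cV[C]_n) :
  complex.Re ((y ^t* *m (A *m x)) 0 0) = \sum_i \sum_j
    (complex.Re ((y i 0)^* * x j 0) * complex.Re (A i j) -
     complex.Im ((y i 0)^* * x j 0) * complex.Im (A i j)).
Proof.
rewrite mxE cRe_sum; apply: eq_bigr => i _; rewrite !mxE mulr_sumr cRe_sum.
by apply: eq_bigr => j _; rewrite -cReM; congr complex.Re; rewrite mulrCA mulrC.
Qed.

Lemma bmeas_Re_dot (F : T -> 'M[C]_n) (x y : 'cV[C]_n) : mbmeas F ->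
  bmeas (fun z => complex.Re ((y ^t* *m (F z *m x)) 0 0)).
Proof.
move=> bF; under eq_fun do rewrite Re_dotE.
apply: bmeas_sum => i; apply: bmeas_sum => j; have [r c] := bF i j.
by apply: bmeasB; exact: bmeasZ.
Qed.

Lemma Re_dot_mxintegral (mu : {finite_measure set T -> \bar R}) (F : T -> 'M[C]_n)
    (x y : 'cV[C]_n) :
  mbmeas F -> complex.Re ((y ^t* *m (mxintegral mu F *m x)) 0 0) =
  \int[mu]_z complex.Re ((y ^t* *m (F z *m x)) 0 0).
Proof.
move=> bF; under eq_Rintegral do rewrite Re_dotE.
have b1 i j : bmeas (fun z => complex.Re ((y i 0)^* * x j 0) * complex.Re (F z i j)).
  by apply: bmeasZ; case: (bF i j).
have b2 i j : bmeas (fun z => complex.Im ((y i 0)^* * x j 0) * complex.Im (F z i j)).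
  by apply: bmeasZ; case: (bF i j).
have b3 i j := bmeasB (b1 i j) (b2 i j).
rewrite (bRintegral_sum mu) => [|i]; last by apply: bmeas_sum => j; exact: b3.
rewrite Re_dotE; apply: eq_bigr => i _.
rewrite (bRintegral_sum mu) => [|j]; last exact: b3.
apply: eq_bigr => j _; have [r c] := bF i j.
by rewrite (bRintegralB mu)// !(bRintegralZ mu)// !mxE.
Qed.

(** The scalar functions [Re (y^* F x)] are bounded by [K |y| |x|], so the real total variation
    bound applies to each of them and no dimension factor appears. *)
Lemma specnorm_mxintegral_diff_le (p q : probability T R) (F : T -> 'M[C]_n) K c :
  mbmeas F -> 0 <= K -> (forall z, specnorm (F z) <= K) ->
  fine (tv_norm (prob_diff p q)) <= c -> 0 <= c ->
  specnorm (mxintegral p F - mxintegral q F) <= K * c.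
Proof.
move=> bF K0 hK hc c0; apply: specnorm_le_dot; first exact: mulr_ge0.
move=> x y.
rewrite mulmxBl mulmxBr mxE [X in _ + X]mxE cReD cReN.
rewrite (Re_dot_mxintegral p)// (Re_dot_mxintegral q)//.
apply: (le_trans (ler_norm _)).
have bd z : `|complex.Re ((y ^t* *m (F z *m x)) 0 0)| <= K * (l2norm y * l2norm x).
  apply: (le_trans (Re_dot_mul_le _ _ _)).
  by rewrite ler_wpM2r// mulr_ge0// l2norm_ge0.
apply: (le_trans (Rintegral_diff_le_tv p q (bmeas_Re_dot x y bF) bd)).
rewrite mulrAC ler_wpM2r// ?mulr_ge0 ?l2norm_ge0//.
by rewrite ler_wpM2l.
Qed.

End matrix_integral.

Section matrix_kernel_operator.
Context (R : realType) d (T : measurableType d) (n : nat) (Q : R.-pker T ~> T).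
Local Notation C := R[i].
Implicit Type F : T -> 'M[C]_n.

Definition kmx F (z : T) : 'M[C]_n := mxintegral (kprob_at Q z) F.

Lemma Re_kmx F i j :
  (fun z => complex.Re (kmx F z i j)) = kop Q (fun z => complex.Re (F z i j)).
Proof. by apply/funext => z; rewrite mxE. Qed.

Lemma Im_kmx F i j :
  (fun z => complex.Im (kmx F z i j)) = kop Q (fun z => complex.Im (F z i j)).
Proof. by apply/funext => z; rewrite mxE. Qed.

Lemma mbmeas_kmx F : mbmeas F -> mbmeas (kmx F).
Proof.
move=> bF i j; have [r c] := bF i j.
by rewrite Re_kmx Im_kmx; split; exact: bmeas_kop.
Qed.

Lemma mbmeas_iter_kmx F k : mbmeas F -> mbmeas (iter k kmx F).
Proof. by move=> bF; elim: k => //= k; exact: mbmeas_kmx. Qed.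

Lemma herm_iter_kmx F k z : mbmeas F -> (forall z, F z \is hermsymmx) ->
  iter k kmx F z \is hermsymmx.
Proof.
move=> bF hF; elim: k z => [|k IH] z; first exact: hF.
rewrite iterS; apply: (mxintegral_herm (kprob_at Q z)) => //.
exact: mbmeas_iter_kmx.
Qed.

Lemma iter_kmxE F k z : mbmeas F ->
  iter k kmx F z = mxintegral (kprob_at (kiter Q k) z) F.
Proof.
move=> bF; apply/matrixP => i j; have [r c] := bF i j; rewrite [RHS]mxE.
have eR : (fun z => complex.Re (iter k kmx F z i j)) =
    iter k (kop Q) (fun z => complex.Re (F z i j)).
  by elim: k => //= k <-; rewrite Re_kmx.
have eI : (fun z => complex.Im (iter k kmx F z i j)) =
    iter k (kop Q) (fun z => complex.Im (F z i j)).
  by elim: k {eR} => //= k <-; rewrite Im_kmx.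
rewrite -kop_kiter// in eR; rewrite -kop_kiter// in eI.
apply/eqP; rewrite eq_complex/=; apply/andP; split; apply/eqP.
  exact: (congr1 (@^~ z) eR).
exact: (congr1 (@^~ z) eI).
Qed.

Context (mu : probability T R) (tmix : nat) (F : T -> 'M[C]_n) (M : R).
Hypothesis tmix0 : (0 < tmix)%N.
Hypothesis mixing : forall k : nat,
  (ereal_sup [set tv_norm (prob_diff (kprob_at (kiter Q k) z) mu) | z in setT]
    <= (2 * (1 / 4) ^+ (k %/ tmix))%:E)%E.
Hypothesis bF : mbmeas F.
Hypothesis hF : forall z, F z \is hermsymmx.
Hypothesis F0 : mxintegral mu F = 0.
Hypothesis FM : forall z, specnorm (F z) <= M.
Hypothesis M0 : 0 <= M.

(** Since [mu(F) = 0], the iterate is a difference of integrals of [F] under two laws whose total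
    variation distance is controlled by [mixing]. *)
Lemma specnorm_iter_kmx_le k z :
  specnorm (iter k kmx F z) <= M * (2 * (1 / 4) ^+ (k %/ tmix)).
Proof.
have c0 : 0 <= 2 * (1 / 4) ^+ (k %/ tmix) :> R by rewrite mulr_ge0// exprn_ge0//; lra.
rewrite iter_kmxE// -[mxintegral _ _]subr0 -F0.
apply: specnorm_mxintegral_diff_le => //.
have : (tv_norm (prob_diff (kprob_at (kiter Q k) z) mu) <=
    (2 * (1 / 4) ^+ (k %/ tmix))%:E)%E.
  by apply: le_trans (mixing k); apply: ereal_sup_ubound; exists z.
by case: (tv_norm _) => //= r; rewrite lee_fin.
Qed.

Lemma sum_geometric_blocks_le r :
  \sum_(i < r) (1 / 4) ^+ (i %/ tmix) <= 4 / 3 * tmix%:R :> R.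
Proof.
have x0 : 0 <= 1 / 4 :> R by lra.
have blocks k : \sum_(0 <= i < k * tmix) (1 / 4) ^+ (i %/ tmix) =
    4 / 3 * tmix%:R * (1 - (1 / 4) ^+ k) :> R.
  elim: k => [|k IH]; first by rewrite mul0n big_nil expr0 subrr mulr0.
  rewrite (@big_cat_nat _ _ _ (k * tmix))//= ?leq_mul2r ?leqnSn ?orbT// IH.
  have -> : \sum_(k * tmix <= i < k.+1 * tmix) (1 / 4) ^+ (i %/ tmix) =
      (1 / 4) ^+ k * tmix%:R :> R.
    rewrite -{1}[(k * tmix)%N]add0n big_addn mulSn addnK.
    rewrite (eq_big_nat _ _ (F2 := fun=> (1 / 4) ^+ k)) => [|i /andP[_ it]].
      by rewrite sumr_const_nat subn0 mulr_natr.
    by rewrite divnDMl// divn_small.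
  by rewrite exprS; lra.
(* The range is enlarged to [r] whole blocks, on each of which the exponent is constant;
   [r <= r * tmix] because [tmix] is positive. *)
apply: (@le_trans _ _ (\sum_(0 <= i < r * tmix) (1 / 4) ^+ (i %/ tmix))).
  rewrite -(big_mkord xpredT (fun i => (1 / 4) ^+ (i %/ tmix))).
  rewrite [leRHS](@big_cat_nat _ _ _ r)//=; last by rewrite leq_pmulr.
  by rewrite lerDl sumr_ge0// => i _; exact: exprn_ge0.
rewrite blocks -[leRHS]mulr1; apply: ler_wpM2l; first by rewrite mulr_ge0//; lra.
by rewrite lerBlDr lerDl exprn_ge0.
Qed.

(** The expected sum of the next [r] values of [F] along the chain from [z], that is, a truncated
    solution of the Poisson equation. *)
Definition pot r z : 'M[C]_n := \sum_(i < r) iter i kmx F z.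

(** The geometric series gives [2 * 4 / 3 = 8 / 3], rounded up to 3. Uniformity in [r] is the point:
    the horizon does not enter. *)
Lemma specnorm_pot_le r z : specnorm (pot r z) <= 3 * tmix%:R * M.
Proof.
apply: (le_trans (specnorm_sum _ _ _)).
apply: (@le_trans _ _ (\sum_(i < r) M * (2 * (1 / 4) ^+ (i %/ tmix)))).
  by apply: ler_sum => i _; exact: specnorm_iter_kmx_le.
rewrite -mulr_sumr -mulr_sumr [leRHS]mulrC ler_wpM2l//.
have := sum_geometric_blocks_le r; have : 0 <= tmix%:R :> R by [].
by move: (\sum_(i < r) _) (tmix%:R) => S t; lra.
Qed.

End matrix_kernel_operator.

Section orthogonality.
Context (R : realType) dO (O : measurableType dO) (P : probability O R).
Local Notation C := R[i].

Definition orth (phi : O -> R) n (X : O -> 'M[C]_n) : Prop := forall a b,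
  \int[P]_w (phi w * complex.Re (X w a b)) = 0 /\
  \int[P]_w (phi w * complex.Im (X w a b)) = 0.

Lemma orth_sum phi n I (r : seq I) (X : I -> O -> 'M[C]_n) : bmeas phi ->
  (forall i, mbmeas (X i)) -> (forall i, orth phi (X i)) ->
  orth phi (fun w => \sum_(i <- r) X i w).
Proof.
move=> bphi bX hX a b.
have br i : bmeas (fun w => phi w * complex.Re (X i w a b)).
  by apply: bmeasM => //; case: (bX i a b).
have bi i : bmeas (fun w => phi w * complex.Im (X i w a b)).
  by apply: bmeasM => //; case: (bX i a b).
split.
  transitivity (\int[P]_w \sum_(i <- r) (phi w * complex.Re (X i w a b))).
    by apply: eq_Rintegral => w _; rewrite summxE cRe_sum mulr_sumr.
  by rewrite (bRintegral_sum P)//; apply: big1 => i _; case: (hX i a b).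
transitivity (\int[P]_w \sum_(i <- r) (phi w * complex.Im (X i w a b))).
  by apply: eq_Rintegral => w _; rewrite summxE cIm_sum mulr_sumr.
by rewrite (bRintegral_sum P)//; apply: big1 => i _; case: (hX i a b).
Qed.

End orthogonality.

(** * The blocked Doob martingale of the chain *)

Section chain_martingale.
Context (R : realType) dT (T : measurableType dT) dO (O : measurableType dO).
Context (Q : R.-pker T ~> T) (xi : probability T R) (P : probability O R).
Variable Z : nat -> O -> T.
Hypothesis mc : markov_chain Q xi P Z.
Local Notation C := R[i].
Variables (n : nat) (F : T -> 'M[C]_n).
Hypothesis bF : mbmeas F.

Let past_meas k : past_gen Z k `<=` measurable.
Proof. exact: past_gen_measurable mc _. Qed.

Lemma mbmeas_state (A : T -> 'M[C]_n) k j : (k <= j)%N -> mbmeas A ->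
  mbmeas (fun w : g_sigma_algebraType (past_gen Z j) => A (Z k w)).
Proof.
move=> kj bA a b; have [r c] := bA a b; have mZ := measurable_state_past (Z := Z) kj.
by split; [exact: (bmeas_comp r mZ)|exact: (bmeas_comp c mZ)].
Qed.

Lemma mbmeas_state_O (A : T -> 'M[C]_n) k : mbmeas A -> mbmeas (fun w => A (Z k w)).
Proof.
move=> bA; have := mbmeas_state (leqnn k) bA.
exact: (mbmeas_g_sigma (@past_meas k)).
Qed.

Lemma orth_kmx j (phi : O -> R) (A : T -> 'M[C]_n) :
  bmeas (phi : g_sigma_algebraType (past_gen Z j) -> R) -> mbmeas A ->
  orth P phi (fun w => A (Z j.+1 w) - kmx Q A (Z j w)).
Proof.
move=> bphi bA a b; have [r c] := bA a b.
have bphi' : bmeas phi by exact: (bmeas_g_sigma (@past_meas j) bphi).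
have [rZ cZ] := mbmeas_state_O j.+1 bA a b.
have [rK cK] := mbmeas_state_O j (mbmeas_kmx Q bA) a b.
split.
  transitivity (\int[P]_w (phi w * complex.Re (A (Z j.+1 w) a b) -
      phi w * complex.Re (kmx Q A (Z j w) a b))).
    by apply: eq_Rintegral => w _; rewrite !mxE cReD cReN mulrBr.
  rewrite (bRintegralB P); [|exact: bmeasM|exact: bmeasM].
  rewrite (markov_bmeas mc bphi r); apply/eqP; rewrite subr_eq0; apply/eqP.
  by apply: eq_Rintegral => w _; rewrite mxE.
transitivity (\int[P]_w (phi w * complex.Im (A (Z j.+1 w) a b) -
    phi w * complex.Im (kmx Q A (Z j w) a b))).
  by apply: eq_Rintegral => w _; rewrite !mxE cImD cImN mulrBr.
rewrite (bRintegralB P); [|exact: bmeasM|exact: bmeasM].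
rewrite (markov_bmeas mc bphi c); apply/eqP; rewrite subr_eq0; apply/eqP.
by apply: eq_Rintegral => w _; rewrite mxE.
Qed.

Variable N : nat.

(* [doob j] is the conditional expectation E(F(Z_0) + ... + F(Z_{N-1}) | Z_0, ..., Z_j)
   for [j <= N]. *)
Definition doob j w : 'M[C]_n :=
  \sum_(i < minn j N) F (Z i w) + pot Q F (N - j) (Z j w).

(** The observed value [F (Z j w)] cancels the leading term of the old potential; the remaining
    terms pair [Q^i F] at time [j + 1] with [Q^(i+1) F] at time [j]. From [N] on, [minn] and the
    truncated subtraction freeze [doob] and both sides vanish. *)
Lemma doob_step j w : doob j.+1 w - doob j w =
  \sum_(i < N - j.+1) (iter i (kmx Q) F (Z j.+1 w) - kmx Q (iter i (kmx Q) F) (Z j w)).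
Proof.
have cancel_ab (a b c e : 'M[C]_n) : a + b + c - (a + (b + e)) = c - e.
  by rewrite (addrA a) opprD addrACA subrr add0r.
rewrite /doob; have [jN|Nj] := ltnP j N.
  rewrite (minn_idPl jN) big_ord_recr/= -(subnSK jN) /pot [in X in _ - X]big_ord_recl/=.
  by rewrite cancel_ab sumrB.
rewrite (minn_idPr (leqW Nj)) /pot.
move: (Nj); rewrite -subn_eq0 => /eqP ->.
by move: (leqW Nj); rewrite -subn_eq0 => /eqP ->; rewrite !big_ord0 subrr.
Qed.

Lemma mbmeas_pot r : mbmeas (pot Q F r).
Proof. by apply: mbmeas_sum => i _; exact: mbmeas_iter_kmx. Qed.

Lemma mbmeas_doob j k : (j <= k)%N ->
  mbmeas (doob j : g_sigma_algebraType (past_gen Z k) -> _).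
Proof.
move=> jk; apply: (@mbmeasD _ _ (g_sigma_algebraType (past_gen Z k))).
  apply: (@mbmeas_sum _ _ (g_sigma_algebraType (past_gen Z k))) => -[i ij] _ /=.
  apply: mbmeas_state => //; rewrite (leq_trans _ jk)//.
  by rewrite (leq_trans (ltnW ij))// geq_minl.
by apply: mbmeas_state => //; exact: mbmeas_pot.
Qed.

(** Telescope into single steps: [phi] stays measurable for every later past, and each term of
    [doob_step] is a one-step Markov increment. *)
Lemma orth_doob a b (phi : O -> R) : (a <= b)%N ->
  bmeas (phi : g_sigma_algebraType (past_gen Z a) -> R) ->
  orth P phi (fun w => doob b w - doob a w).
Proof.
move=> ab bphi.
have bphi' : bmeas phi by exact: (bmeas_g_sigma (@past_meas a) bphi).
have -> : (fun w => doob b w - doob a w) =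
    (fun w => \sum_(i < b - a) (doob (a + i).+1 w - doob (a + i) w)).
  apply/funext => w; rewrite -(telescope_sumr (fun j => doob j w) ab) -{1}[a]add0n.
  rewrite big_addn big_mkord.
  by apply: eq_bigr => i _; rewrite addnC.
have step i : (fun w => doob (a + i).+1 w - doob (a + i) w) =
    (fun w => \sum_(l < N - (a + i).+1) (iter l (kmx Q) F (Z (a + i).+1 w) -
      kmx Q (iter l (kmx Q) F) (Z (a + i) w))).
  by apply/funext => w; exact: doob_step.
have bterm i l : mbmeas (fun w => iter l (kmx Q) F (Z (a + i).+1 w) -
      kmx Q (iter l (kmx Q) F) (Z (a + i) w)).
  have bl := mbmeas_iter_kmx Q l bF.
  by apply: mbmeasB; apply: mbmeas_state_O => //; exact: mbmeas_kmx.
apply: orth_sum => // i; rewrite step; first by apply: mbmeas_sum => l _; exact: bterm.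
apply: orth_sum => // l; apply: orth_kmx; last exact: mbmeas_iter_kmx.
exact: bmeas_past_le (leq_addr _ _) bphi.
Qed.

Context (mu : probability T R) (tmix : nat) (M : R).
Hypothesis tmix0 : (0 < tmix)%N.
Hypothesis mixing : forall k : nat,
  (ereal_sup [set tv_norm (prob_diff (kprob_at (kiter Q k) z) mu) | z in setT]
    <= (2 * (1 / 4) ^+ (k %/ tmix))%:E)%E.
Hypothesis hF : forall z, F z \is hermsymmx.
Hypothesis F0 : mxintegral mu F = 0.
Hypothesis FM : forall z, specnorm (F z) <= M.
Hypothesis M0 : 0 <= M.

Let pot_le r z : specnorm (pot Q F r z) <= 3 * tmix%:R * M.
Proof. exact: specnorm_pot_le tmix0 mixing bF F0 FM M0 r z. Qed.

(** Here [7 = 1 + 3 + 3]: at most one block of values of [F], and two potentials. The same count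
    serves the block differences and the distance to the partial sums. *)
Let specnorm_sum_pot_le (A B B' : 'M[C]_n) :
  specnorm A <= tmix%:R * M -> specnorm B <= 3 * tmix%:R * M ->
  specnorm B' <= 3 * tmix%:R * M -> specnorm (A + (B - B')) <= 7 * tmix%:R * M.
Proof.
move=> hA hB hC; apply: (le_trans (specnormD _ _)).
apply: (le_trans (lerD hA (specnormD _ _))); rewrite specnormN.
apply: (le_trans (lerD (lexx _) (lerD hB hC))).
by rewrite le_eqVlt; apply/orP; left; apply/eqP; ring.
Qed.

Definition block_diff r w : 'M[C]_n := doob (r.+1 * tmix) w - doob (r * tmix) w.

Lemma doob_herm j w : doob j w \is hermsymmx.
Proof.
apply: hermsymmxD; apply: hermsymmx_sum => i; first exact: hF.
exact: herm_iter_kmx.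
Qed.

Lemma specnorm_sum_F_le a b w :
  specnorm (\sum_(a <= i < b) F (Z i w)) <= (b - a)%:R * M.
Proof.
apply: (le_trans (specnorm_sum _ _ _)).
apply: (@le_trans _ _ (\sum_(a <= i < b) M)); first by apply: ler_sum => i _.
by rewrite sumr_const_nat mulr_natl.
Qed.

Lemma specnorm_block_diff_le r w : specnorm (block_diff r w) <= 7 * tmix%:R * M.
Proof.
set a := minn (r * tmix) N; set b := minn (r.+1 * tmix) N.
have ab : (a <= b)%N by rewrite /a /b mulSn; lia.
have -> : block_diff r w = \sum_(a <= i < b) F (Z i w) +
    (pot Q F (N - r.+1 * tmix) (Z (r.+1 * tmix) w) -
     pot Q F (N - r * tmix) (Z (r * tmix) w)).
  rewrite /block_diff /doob -/a -/b -!(big_mkord xpredT (fun i => F (Z i w))).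
  rewrite (@big_cat_nat _ _ _ a 0 b)//= opprD addrACA.
  by rewrite (addrC (\sum_(0 <= i < a) _)) addrK.
have ba : (b - a <= tmix)%N by rewrite /a /b mulSn; lia.
apply: specnorm_sum_pot_le; last exact: pot_le.
  by apply: (le_trans (specnorm_sum_F_le _ _ _)); rewrite ler_wpM2r// ler_nat.
exact: pot_le.
Qed.

Lemma block_martingale_differences :
  martingale_differences P (fun i => past_gen Z (i * tmix)) block_diff (7 * tmix%:R * M).
Proof.
split.
- by move=> i; exact: past_meas.
- move=> i j ij; apply: (@mbmeasB _ _ (g_sigma_algebraType (past_gen Z (j * tmix)))).
    by apply: mbmeas_doob; rewrite leq_mul2r ij orbT.
  by apply: mbmeas_doob; rewrite leq_mul2r (ltnW ij) orbT.
- by move=> i w; apply: hermsymmxD; [|apply: hermsymmxN]; exact: doob_herm.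
- exact: specnorm_block_diff_le.
- by move=> i phi a b bphi; apply: (orth_doob _ bphi); rewrite leq_mul2r leqnSn orbT.
Qed.

Lemma mart_block_diff k w : mart block_diff k w = doob (k * tmix) w - doob 0 w.
Proof.
rewrite /mart -(big_mkord xpredT (fun j => block_diff j w)).
by rewrite (telescope_sumr (fun j => doob (j * tmix) w)).
Qed.

(** Compare with the last block boundary before [k]. The potential at [Z 0], which is [doob 0], is
    the price of the arbitrary initial law, and it is bounded uniformly in the starting point. *)
Lemma partial_sum_le k w : (k <= N)%N ->
  specnorm (partial_sum F Z k w) <=
  specnorm (mart block_diff (k %/ tmix) w) + 7 * tmix%:R * M.
Proof.
move=> kN; set r := (k %/ tmix)%N.
have rk : (r * tmix <= k)%N by exact: leq_divM.
have -> : partial_sum F Z k w = mart block_diff r w +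
    (\sum_(r * tmix <= i < k) F (Z i w) + (pot Q F N (Z 0 w) -
     pot Q F (N - r * tmix) (Z (r * tmix) w))).
  rewrite mart_block_diff /doob min0n big_ord0 subn0 add0r (minn_idPl (leq_trans rk kN)).
  rewrite /partial_sum -!(big_mkord xpredT (fun i => F (Z i w))).
  rewrite (@big_cat_nat _ _ _ (r * tmix) 0 k)//=.
  have e (a b c f : 'M[C]_n) : a + b = a + c - f + (b + (f - c)).
    by rewrite -(addrA a) -(opprB f c) (addrC b) addrA subrK.
  exact: e.
apply: (le_trans (specnormD _ _)); rewrite lerD2l.
have kr : (k - r * tmix <= tmix)%N.
  by rewrite {1}(divn_eq k tmix) -/r addKn ltnW// ltn_pmod.
apply: specnorm_sum_pot_le; last exact: pot_le.
  by apply: (le_trans (specnorm_sum_F_le _ _ _)); rewrite ler_wpM2r// ler_nat.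
exact: pot_le.
Qed.

End chain_martingale.

(** * Numerical constants *)

Section constants.
Context (R : realType).

Lemma expR1_le4 : expR 1 <= 4 :> R.
Proof.
have h : 1 / 2 <= expR (- (1 / 2)) :> R by apply: le_trans (expR_ge1Dx _); lra.
have h2 : expR (1 / 2) <= 2 :> R.
  by rewrite -[1 / 2]opprK expRN invf_ple ?posrE ?expR_gt0//; lra.
rewrite (_ : 1 = 2%:R * (1 / 2)); last by lra.
rewrite expRM_natl; apply: (@le_trans _ _ (2 ^+ 2)); last by lra.
by rewrite lerXn2r ?nnegrE ?expR_ge0.
Qed.

Lemma one_le_log (d : nat) (delta : R) : (0 < d)%N -> 0 < delta -> delta < 1 ->
  1 <= ln (expR 1 * d%:R / delta).
Proof.
move=> d0 del0 del1; have e0 : 0 < expR 1 :> R := expR_gt0 1.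
have d1 : 1 <= d%:R :> R by rewrite ler1n.
rewrite -ler_expR lnK ?posrE ?divr_gt0 ?mulr_gt0 ?ltr0n// ler_pdivlMr// ler_pM2l//.
by rewrite (le_trans (ltW del1)).
Qed.

(* [7 * tmix * M] bounds the differences of the block martingale. *)
Lemma tail_constant (d n m tmix : nat) (delta M a : R) :
  (0 < d)%N -> (0 < tmix)%N -> (m * tmix <= n)%N -> 0 < delta -> delta < 1 ->
  0 <= M -> 0 <= a ->
  let L := ln (expR 1 * d%:R / delta) in
  let q := (Num.truncn L).+1 in
  a ^+ 2 = n%:R * (L * tmix%:R * M ^+ 2) ->
  d%:R * (4 * q%:R * ((7 * tmix%:R * M) ^+ 2 * (m + q)%:R)) ^+ q <=
    delta * (60 * a + 60 * (L * tmix%:R * M)) ^+ (2 * q).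
Proof.
move=> d0 t0 mn del0 del1 M0 a0 L q a2.
have e0 : 0 < expR 1 :> R := expR_gt0 1.
have d1 : 1 <= d%:R :> R by rewrite ler1n.
have arg0 : 0 < expR 1 * d%:R / delta by rewrite divr_gt0// mulr_gt0// (lt_le_trans _ d1).
have eL : expR L = expR 1 * d%:R / delta by rewrite lnK ?posrE.
have L1 : 1 <= L by exact: one_le_log.
have Lq : L <= q%:R by exact/ltW/truncnS_gt.
have qL : q%:R <= 2 * L.
  rewrite /q -natr1; have := truncn_itv (le_trans ler01 L1) => /andP[h _]; lra.
set c := L * tmix%:R * M.
have c0 : 0 <= c by rewrite !mulr_ge0// (le_trans ler01 L1).
set t := 60 * a + 60 * c.
(* With [q <= 2 L] and [m tmix <= n], the left side is at most [392 a^2 + 784 c^2], where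
   [196 = 4 * 7^2]. Multiplying by [e <= 4] gives [1568 a^2 + 3136 c^2], which [60^2 = 3600]
   dominates. *)
have base : 4 * q%:R * ((7 * tmix%:R * M) ^+ 2 * (m + q)%:R) <= t ^+ 2 / expR 1.
  rewrite ler_pdivlMr//.
  set B := _ * (_ * _).
  have B1 : B <= 392 * a ^+ 2 + 784 * c ^+ 2.
    have mn' : m%:R * tmix%:R <= n%:R :> R by rewrite -natrM ler_nat.
    rewrite a2 /B /c natrD.
    have tM0 : 0 <= tmix%:R * M ^+ 2 by rewrite mulr_ge0// sqr_ge0.
    have -> : 4 * q%:R * ((7 * tmix%:R * M) ^+ 2 * (m%:R + q%:R)) =
      (196 * (tmix%:R * M ^+ 2)) * (q%:R * (m%:R * tmix%:R + q%:R * tmix%:R)) by ring.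
    have -> : 392 * (n%:R * (L * tmix%:R * M ^+ 2)) + 784 * (L * tmix%:R * M) ^+ 2 =
      (196 * (tmix%:R * M ^+ 2)) * (2 * L * (n%:R + 2 * L * tmix%:R)) by ring.
    apply: ler_wpM2l; first by rewrite mulr_ge0.
    apply: ler_pM => //.
    by apply: lerD => //; rewrite ler_wpM2r.
  have B0 : 0 <= B by rewrite !mulr_ge0 ?sqr_ge0.
  apply: (@le_trans _ _ (B * 4)); first by rewrite ler_wpM2l// expR1_le4.
  have ac : 0 <= a * c by rewrite mulr_ge0.
  have aa := sqr_ge0 a; have cc := sqr_ge0 c.
  rewrite /t; have -> : (60 * a + 60 * c) ^+ 2 =
    3600 * a ^+ 2 + 7200 * (a * c) + 3600 * c ^+ 2 by ring.
  apply: (le_trans (ler_wpM2r _ B1)) => //.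
  by move: (a ^+ 2) (a * c) (c ^+ 2) ac aa cc => x y z; lra.
have q0 : 0 <= 4 * q%:R * ((7 * tmix%:R * M) ^+ 2 * (m + q)%:R).
  by rewrite !mulr_ge0 ?sqr_ge0.
apply: (@le_trans _ _ (d%:R * (t ^+ 2 / expR 1) ^+ q)).
  by rewrite ler_wpM2l// lerXn2r ?nnegrE// (le_trans q0 base).
rewrite expr_div_n -exprM mulrCA mulrC; apply: ler_wpM2r.
  by rewrite exprn_ge0// addr_ge0// mulr_ge0.
rewrite ler_pdivrMr ?exprn_gt0// -expRM_natl mulr1.
(* From [L <= q], [delta * exp q] is at least [delta * exp L = e d], which exceeds [d]. *)
apply: (@le_trans _ _ (delta * expR L)); last by rewrite ler_wpM2l ?(ltW del0)// ler_expR.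
have e1 : 1 <= expR 1 :> R by have := @expR_ge1Dx R 1; lra.
by rewrite eL mulrC divfK ?gt_eqF// ler_peMl.
Qed.

End constants.

(** * The deviation event *)

Section deviation_event.
Context (R : realType) dO (O : measurableType dO) (n : nat).
Local Notation C := R[i].

Lemma measurable_specnorm_le (X : O -> 'M[C]_n) c : mbmeas X ->
  (forall w, X w \is hermsymmx) -> 0 <= c -> measurable [set w | specnorm (X w) <= c].
Proof.
move=> bX hX c0.
have -> : [set w | specnorm (X w) <= c] =
    \bigcap_q [set w | retr (X w ^+ (2 * q)) <= n%:R * c ^+ (2 * q)].
  apply/seteqP; split=> w /=.
    by move=> /(specnorm_leP (hX w) c0) h q _; exact: h.
  by move=> h; apply/(specnorm_leP (hX w) c0) => q; exact: h.
apply: bigcap_measurable; first by exists 0%N.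
move=> q _; apply: measurable_bmeas_le; apply: bmeas_retr; exact: mbmeasX.
Qed.

(** The bound [K] only ensures that [sup] is a true supremum. The finite intersection makes the
    event measurable and lets it be checked one index at a time. *)
Lemma sup_specnorm_leE (S : nat -> O -> 'M[C]_n) (N : nat) (K c : R) :
  (0 < N)%N -> (forall k w, (k <= N)%N -> specnorm (S k w) <= K) ->
  [set w | N%:R^-1 * sup [set specnorm (S k w) | k in [set k | (k <= N)%N]] <= c] =
  \bigcap_(k in `I_N.+1) [set w | specnorm (S k w) <= N%:R * c].
Proof.
move=> N0 hK; have N0' : 0 < N%:R :> R by rewrite ltr0n.
apply/seteqP; split=> w /=; rewrite ler_pdivrMl//.
  move=> h k kN; apply: le_trans h; apply: ub_le_sup; last by exists k.
  by exists K => _ [j /= jN <-]; exact: hK.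
move=> h; apply: ge_sup; first by exists (specnorm (S 0%N w)), 0%N.
by move=> _ [k /= kN <-]; exact: h.
Qed.

End deviation_event.

Theorem corollary2p1 (R : realType) :
  exists D5 D6 : R, 0 < D5 /\ 0 < D6 /\
  forall (dT : measure_display) (T : measurableType dT)
         (Q : R.-pker T ~> T) (mu : probability T R) (tmix : nat)
         (d : nat) (F : T -> 'M[R[i]]_d),
    unique_stationary Q mu ->
    (0 < tmix)%N ->
    (forall k : nat,
       (ereal_sup [set tv_norm (prob_diff (kprob_at (kiter Q k) z) mu)
                  | z in setT]
        <= (2 * (1 / 4) ^+ (k %/ tmix))%:E)%E) ->
    (0 < d)%N ->
    (forall z, F z \is hermsymmx) ->
    measurable_mx_fun F ->
    mxintegral mu F = 0 ->
    (mxsupnorm F < +oo)%E ->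
    forall (delta : R) (n : nat) (xi : probability T R),
      0 < delta -> delta < 1 -> (1 <= n)%N ->
      forall (dO : measure_display) (O : measurableType dO)
             (P : probability O R) (Z : nat -> O -> T),
        markov_chain Q xi P Z ->
        let M := fine (mxsupnorm F) in
        let L := ln (expR 1 * d%:R / delta) in
        let bound := D5 * Num.sqrt (L * tmix%:R * M ^+ 2 / n%:R)
                     + D6 * (L * tmix%:R * M / n%:R) in
        ((1 - delta)%:E <=
         P [set w | (n%:R^-1 * sup [set specnorm (partial_sum F Z k w)
                                   | k in [set k | (k <= n)%N]]
                     <= bound)%R])%E.
Proof.
(* The 60 is the constant of [tail_constant]; [67 = 60 + 7] adds the distance between partial sums
   and the block martingale. *)
exists 60, 67; do 2![split; first by []].
move=> dT T Q mu tmix d F _ t0 mixing d0 hF mF F0 Fy delta n xi del0 del1 n1.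
move=> dO O P Z mc; cbv zeta.
set M := fine _; set L := ln _; set bound := 60 * _ + _.
have Fle z : ((specnorm (F z))%:E <= mxsupnorm F)%E.
  by apply: ereal_sup_ubound; exists z.
have FM z : specnorm (F z) <= M.
  by rewrite -lee_fin fineK// ge0_fin_numE// (le_trans _ (Fle z))// lee_fin specnorm_ge0.
have M0 : 0 <= M.
  have [[z _]|noz] := pselect (exists z : T, True).
    by rewrite (le_trans _ (FM z))// specnorm_ge0.
  (* Over an empty state space the supremum is [-oo], whose [fine] is 0. *)
  rewrite /M /mxsupnorm (_ : [set _ | _ in _] = set0) ?ereal_sup0//.
  by apply/seteqP; split=> // x [z _ _]; case: noz; exists z.
have bF : mbmeas F.
  move=> i j; have [r c] := mF i j; split; split=> //; exists M => z.
    by rewrite (le_trans (Re_le_normc _))// (le_trans (normc_le_specnorm _ _ _)).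
  by rewrite (le_trans (Im_le_normc _))// (le_trans (normc_le_specnorm _ _ _)).
have n0 : 0 < n%:R :> R by rewrite ltr0n.
(* Scaling by [n] turns the bound into [60 a + 67 c], with [a ^+ 2] free of roots and quotients. *)
pose a := n%:R * Num.sqrt (L * tmix%:R * M ^+ 2 / n%:R).
have a0 : 0 <= a by rewrite mulr_ge0// sqrtr_ge0.
have mn : ((n %/ tmix) * tmix <= n)%N by exact: leq_divM.
have L1 : 1 <= L by exact: one_le_log.
have L0 : 0 <= L := le_trans ler01 L1.
have a2 : a ^+ 2 = n%:R * (L * tmix%:R * M ^+ 2).
  rewrite /a exprMn sqr_sqrtr; last by rewrite divr_ge0// !mulr_ge0// sqr_ge0.
  by rewrite expr2 -mulrA; congr (_ * _); rewrite mulrC divfK// gt_eqF.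
have tail := tail_constant d0 t0 mn del0 del1 M0 a0 a2.
move: tail; rewrite -/L; set q := (Num.truncn L).+1; set c := L * tmix%:R * M.
set t := 60 * a + 60 * c; set m := (n %/ tmix)%N => tail.
have c0 : 0 <= c by rewrite !mulr_ge0.
have t_ge0 : 0 <= t by rewrite addr_ge0// mulr_ge0.
have nbound : n%:R * bound = t + 7 * c.
  rewrite /bound mulrDr mulrCA -/a (_ : n%:R * (67 * _) = 67 * c); first by rewrite /t; ring.
  by rewrite mulrCA (mulrC n%:R) divfK// gt_eqF.
have nb0 : 0 <= n%:R * bound by rewrite nbound addr_ge0// mulr_ge0.
have Sherm k w : partial_sum F Z k w \is hermsymmx by apply: hermsymmx_sum.
have bS k : mbmeas (partial_sum F Z k).
  by apply: mbmeas_sum => i _; exact: (mbmeas_state_O mc).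
have SM k w : (k <= n)%N -> specnorm (partial_sum F Z k w) <= n%:R * M.
  move=> kn; apply: (le_trans (specnorm_sum _ _ _)).
  apply: (@le_trans _ _ (\sum_(i < k) M)); first by apply: ler_sum => i _.
  rewrite sumr_const card_ord -[leLHS]mulr_natl; apply: ler_wpM2r => //.
  by rewrite ler_nat.
rewrite (@sup_specnorm_leE _ _ _ _ _ n (n%:R * M))//.
set E := \bigcap_(_ in _) _.
have mE : measurable E.
  apply: fin_bigcap_measurable; first exact: finite_II.
  by move=> k _; exact: measurable_specnorm_le.
(* For [M = 0] the threshold [t] is zero and its power cannot be cancelled from the tail bound, but
   then all partial sums vanish. *)
have [M00|Mneq] := eqVneq M 0.
  rewrite (_ : E = setT) ?probability_setT ?lee_fin; first by rewrite gerBl ltW.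
  apply/seteqP; split=> // w _ k kn; apply: le_trans nb0.
  by apply: (le_trans (SM k w kn)); rewrite M00 mulr0.
have Mgt0 : 0 < M by rewrite lt_def Mneq M0.
have tp : 0 < t.
  apply: (@lt_le_trans _ _ (60 * c)); last by rewrite lerDr mulr_ge0.
  rewrite mulr_gt0// mulr_gt0// mulr_gt0 ?ltr0n//.
  exact: lt_le_trans ltr01 L1.
have hD := block_martingale_differences mc bF n t0 mixing hF F0 FM M0.
set D := block_diff _ _ _ _ _ in hD.
have mU := measurable_trace_below_upto hD q t m.
have UE : trace_below_upto D q t m `<=` E.
  move=> w /trace_below_uptoP hU k kn; have {}kn : (k <= n)%N by [].
  rewrite /mkset nbound.
  have Sk := partial_sum_le Z bF t0 mixing F0 FM M0 w kn.
  apply: (le_trans Sk).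
  apply: lerD.
    apply: (@specnorm_le_retr _ _ _ q) => //; first exact: (mart_herm hD).
    by apply: hU; exact: leq_div2r.
  (* The remainder [7 tmix M] is at most [7 c] because [L >= 1]. *)
  by rewrite -mulrA ler_wpM2l// /c ler_wpM2r// ler_peMl.
apply: (@le_trans _ _ (P (trace_below_upto D q t m))); last first.
  by apply: le_measure => //; rewrite inE.
have fin : P (trace_below_upto D q t m) \is a fin_num by exact: fin_num_measure.
(* Cancelling [t ^+ (2 * q)], which is positive, bounds the probability of leaving the ball by
   [delta]. *)
have := le_trans (martingale_maximal_tail hD q t m) tail.
rewrite mulrC ler_pM2r ?exprn_gt0// probability_setC// -(fineK fin).
by rewrite -EFinB/= lee_fin => h; rewrite lerBlDr addrC -lerBlDr.
Qed.
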